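(* Let $R$ be an arbitrary commutative ring and $l\geq 4$. Let $\phi\colon \mathrm{StSp}(2l,R)\to \mathrm{Ep}(2l,R)$, $X_{ij}(a)\mapsto T_{ij}(a)$, be the natural projection from the symplectic Steinberg group onto the elementary symplectic group and $\mathrm{K_2Sp}(2l,R)=\mathrm{Ker}\,\phi$. Then $\mathrm{K_2Sp}(2l,R)= \mathrm{H}_2(\mathrm{Ep}(2l,R),\mathbb Z)$, i.e. $\mathrm{K_2Sp}(2l,R)$ is (isomorphic to) the Schur multiplier of $\mathrm{Ep}(2l,R)$.
   Context: Rings are associative, commutative and unital. $V=R^{2l}$ is the free right $R$-module with basis $e_{-l},\dots,e_{-1},e_1,\dots,e_l$; indices $i,j,h,k$ run over $\{-l,\dots,-1,1,\dots,l\}$. Write $\varepsilon_i=\mathrm{sgn}(i)\in\{1,-1\}$. The symplectic form is the bilinear form with $\langle e_i,e_j\rangle=\varepsilon_i\delta_{i,-j}$, and $\mathrm{Sp}(2l,R)$ is the group of $R$-linear automorphisms of $V$ preserving it. Commutators are $[x,y]=xyx^{-1}y^{-1}$. For $u,v\in V$ with $\langle u,v\rangle=0$ and $a\in R$, $T(u,v,a)\in\mathrm{Sp}(2l,R)$ is the map $w\mapsto w+u(\langle v,w\rangle+a\langle u,w\rangle)+v\langle u,w\rangle$. Put $T_{ij}(a)=T(e_i,e_{-j}a\varepsilon_{-j},0)$ for $i\notin\{\pm j\}$ and $T_{i,-i}(a)=T(e_i,0,a)$. The elementary symplectic group $\mathrm{Ep}(2l,R)$ is the subgroup of $\mathrm{Sp}(2l,R)$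 generated by all $T_{ij}(a)$, $i\ne j$, $a\in R$. The symplectic Steinberg group $\mathrm{StSp}(2l,R)$ is the group generated by symbols $X_{ij}(a)$, $i\neq j$, $a\in R$, subject to the relations (each imposed only when all symbols in it are defined, i.e. no symbol $X_{ii}$ appears): R0: $X_{ij}(a)=X_{-j,-i}(-a\varepsilon_i\varepsilon_j)$; R1: $X_{ij}(a)X_{ij}(b)=X_{ij}(a+b)$; R2: $[X_{ij}(a),X_{hk}(b)]=1$ for $h\notin\{j,-i\}$, $k\notin\{i,-j\}$; R3: $[X_{ij}(a),X_{jk}(b)]=X_{ik}(ab)$ for $i\notin\{-j,-k\}$, $j\ne -k$; R4: $[X_{i,-i}(a),X_{-i,j}(b)]=X_{ij}(ab\varepsilon_i)X_{-j,j}(-ab^2)$; R5: $[X_{ij}(a),X_{j,-i}(b)]=X_{i,-i}(2ab\varepsilon_i)$. The assignment $X_{ij}(a)\mapsto T_{ij}(a)$ defines the natural epimorphism $\phi$. $\mathrm H_2(G,\mathbb Z)$ denotes the second integral group homology (trivial coefficients). *)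

(* Defs.v *)
Set Warnings "-notation-overridden,-ambiguous-paths,-redundant-canonical-projection,-projection-no-head-constant".
From HB Require Import structures.
From mathcomp Require Import all_boot all_order all_algebra.
From mathcomp Require Import boolp.
From mathcomp Require Import ring.
From mathcomp Require Import freeg.

Set Implicit Arguments.
Unset Strict Implicit.
Unset Printing Implicit Defensive.

Import GRing.Theory.
Local Open Scope ring_scope.
Local Open Scope quotient_scope.

Inductive gterm (X : Type) : Type :=
| tone
| tgen of X
| tmul of gterm X & gterm X
| tinv of gterm X.
Arguments tone {X}.

HB.instance Definition _ (X : Type) := gen_eqMixin (gterm X).
HB.instance Definition _ (X : Type) := gen_choiceMixin (gterm X).

(* Unlike mathcomp's [~ x, y] = x^-1 * y^-1 * x * y, the convention here is   *)
(* [x, y] = x * y * x^-1 * y^-1.                                              *)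
Definition tcomm (X : Type) (x y : gterm X) : gterm X :=
  tmul (tmul (tmul x y) (tinv x)) (tinv y).

Fixpoint geval (X : Type) (G : groupType) (f : X -> G) (t : gterm X) : G :=
  match t with
  | tone => 1%g
  | tgen x => f x
  | tmul t u => (geval f t * geval f u)%g
  | tinv t => (geval f t)^-1%g
  end.

Section Presentation.

Variables (X : Type) (rel : gterm X -> gterm X -> Prop).

(* The group generated by X subject to rel is the quotient of the group terms *)
(* over X by the least congruence that contains rel and the group axioms.     *)
Inductive pcong : gterm X -> gterm X -> Prop :=
| pc_rel t u of rel t u : pcong t u
| pc_refl t : pcong t t
| pc_sym t u of pcong t u : pcong u t
| pc_trans t u v of pcong t u & pcong u v : pcong t v
| pc_mul t t' u u' of pcong t t' & pcong u u' : pcong (tmul t u) (tmul t' u')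
| pc_inv t t' of pcong t t' : pcong (tinv t) (tinv t')
| pc_mulA t u v : pcong (tmul t (tmul u v)) (tmul (tmul t u) v)
| pc_mul1 t : pcong (tmul tone t) t
| pc_1mul t : pcong (tmul t tone) t
| pc_mulV t : pcong (tmul (tinv t) t) tone
| pc_Vmul t : pcong (tmul t (tinv t)) tone.

Definition pcongb (t u : gterm X) : bool := `[< pcong t u >].

Lemma pcongb_is_equiv : equiv_class_of pcongb.
Proof.
split=> [t|t u|u t v].
- exact/asboolP/pc_refl.
- by apply/idP/idP => /asboolP h; exact/asboolP/pc_sym.
- by move=> /asboolP h /asboolP k; exact/asboolP/(pc_trans h k).
Qed.

Canonical pcongb_equiv := EquivRelPack pcongb_is_equiv.
Canonical pcongb_encModRel := defaultEncModRel pcongb.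

Definition presented : Type := {eq_quot pcongb}.

HB.instance Definition _ : EqQuotient _ pcongb presented :=
  EqQuotient.on presented.
HB.instance Definition _ := Choice.on presented.

Lemma pres_eqP (t u : gterm X) :
  pcong t u <-> \pi_presented t = \pi_presented u.
Proof. by split=> [h|/eqmodP/asboolP//]; apply/eqmodP/asboolP. Qed.

Lemma repr_pi_pcong (t : gterm X) : pcong (repr (\pi_presented t)) t.
Proof. by apply/pres_eqP; rewrite reprK. Qed.

Definition pres_one : presented := \pi_presented tone.
Definition pres_mul (x y : presented) : presented :=
  \pi_presented (tmul (repr x) (repr y)).
Definition pres_inv (x : presented) : presented :=
  \pi_presented (tinv (repr x)).

Lemma pres_mulE t u :
  pres_mul (\pi_presented t) (\pi_presented u) = \pi_presented (tmul t u).
Proof. by apply/pres_eqP/pc_mul; exact: repr_pi_pcong. Qed.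

Lemma pres_invE t : pres_inv (\pi_presented t) = \pi_presented (tinv t).
Proof. by apply/pres_eqP/pc_inv; exact: repr_pi_pcong. Qed.

Lemma pres_mulA : associative pres_mul.
Proof.
elim/quotW=> x; elim/quotW=> y; elim/quotW=> z.
rewrite (pres_mulE y z) (pres_mulE x y) (pres_mulE x) (pres_mulE _ z).
by apply/pres_eqP; exact: pc_mulA.
Qed.
Lemma pres_mul1 : left_id pres_one pres_mul.
Proof. by elim/quotW=> x; rewrite pres_mulE; apply/pres_eqP; exact: pc_mul1. Qed.
Lemma pres_1mul : right_id pres_one pres_mul.
Proof. by elim/quotW=> x; rewrite pres_mulE; apply/pres_eqP; exact: pc_1mul. Qed.
Lemma pres_mulV : left_inverse pres_one pres_inv pres_mul.
Proof.
by elim/quotW=> x; rewrite pres_invE pres_mulE; apply/pres_eqP; exact: pc_mulV.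
Qed.
Lemma pres_Vmul : right_inverse pres_one pres_inv pres_mul.
Proof.
by elim/quotW=> x; rewrite pres_invE pres_mulE; apply/pres_eqP; exact: pc_Vmul.
Qed.

HB.instance Definition _ := isGroup.Build presented
  pres_mulA pres_mul1 pres_1mul pres_mulV pres_Vmul.

Definition pres_gen (x : X) : presented := \pi_presented (tgen x).

Section Lift.

Variables (G : groupType) (f : X -> G).
Hypothesis f_rel : forall t u, rel t u -> geval f t = geval f u.

Lemma geval_pcong t u : pcong t u -> geval f t = geval f u.
Proof.
elim=> {t u} //=.
- by move=> t u v _ -> _ ->.
- by move=> t t' u u' _ -> _ ->.
- by move=> t t' _ ->.
- by move=> t u v; rewrite mulgA.
- by move=> t; rewrite mul1g.
- by move=> t; rewrite mulg1.
- by move=> t; rewrite mulVg.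
- by move=> t; rewrite mulgV.
Qed.

Definition pres_lift (x : presented) : G := geval f (repr x).

Lemma pres_lift_pi t : pres_lift (\pi_presented t) = geval f t.
Proof. exact/geval_pcong/repr_pi_pcong. Qed.

Lemma pres_lift_gen x : pres_lift (pres_gen x) = f x.
Proof. exact: pres_lift_pi. Qed.

Lemma pres_liftM : {morph pres_lift : x y / (x * y)%g}.
Proof.
elim/quotW=> x; elim/quotW=> y; rewrite [(_ * _)%g]pres_mulE.
by rewrite !pres_lift_pi.
Qed.

End Lift.
End Presentation.

Section Generated.

Variables (G : groupType) (A : G -> Prop).

Inductive generated : G -> Prop :=
| gen_one : generated 1%g
| gen_in x of A x : generated x
| gen_mul x y of generated x & generated y : generated (x * y)%g
| gen_inv x of generated x : generated (x^-1)%g.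

Lemma generated_group_closed : group_closed (fun x => `[< generated x >]).
Proof.
split=> [|x y /asboolP hx /asboolP hy]; apply/asboolP; first exact: gen_one.
exact/gen_mul/gen_inv.
Qed.

End Generated.

(* H_2(G, Z) is computed by the inhomogeneous bar complex with trivial        *)
(* coefficients, whose chains of degree n form the free abelian group on G^n. *)
Section SecondHomology.

Variable G : groupType.

Definition bar_d2 : {freeg (G * G)%type} -> {freeg G} :=
  fglift (fun x : G * G =>
    << x.2 >> - << (x.1 * x.2)%g >> + << x.1 >> : {freeg G}).

Definition bar_d3 : {freeg (G * G * G)%type} -> {freeg (G * G)%type} :=
  fglift (fun x : G * G * G => let: (g, h, k) := x in
    << (h, k) >> - << ((g * h)%g, k) >> + << (g, (h * k)%g) >> - << (g, h) >>
      : {freeg (G * G)%type}).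

Definition is_cycle2 (c : {freeg (G * G)%type}) : bool := bar_d2 c == 0.

Record cycles2 := Cycle2 {
  cycle2_val :> {freeg (G * G)%type};
  cycle2_valP : is_cycle2 cycle2_val }.

HB.instance Definition _ := [isSub for cycle2_val].
HB.instance Definition _ := [Choice of cycles2 by <:].

Lemma cycles2_zmod_closed : zmod_closed is_cycle2.
Proof.
have dB : zmod_morphism bar_d2 by exact: lift_is_additive.
have d0 : bar_d2 0 = 0 by rewrite -(subrr 0) dB subrr.
split=> [|x y]; rewrite unfold_in /is_cycle2 ?d0 // => /eqP hx /eqP hy.
by rewrite unfold_in /is_cycle2 dB hx hy subrr.
Qed.
HB.instance Definition _ :=
  GRing.SubChoice_isSubZmodule.Build _ _ cycles2 cycles2_zmod_closed.

Definition boundary2 : {pred cycles2} := fun c =>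
  `[< exists b, val c = bar_d3 b >].

Lemma boundary2_zmod_closed : zmod_closed boundary2.
Proof.
have dB : zmod_morphism bar_d3 by exact: lift_is_additive.
have d0 : bar_d3 0 = 0 by rewrite -(subrr 0) dB subrr.
split=> [|x y /asboolP[b hb] /asboolP[c hc]]; apply/asboolP.
  by exists 0; rewrite raddf0 d0.
by exists (b - c); rewrite raddfB /= dB -hb -hc.
Qed.
HB.instance Definition _ :=
  GRing.isZmodClosed.Build cycles2 boundary2 boundary2_zmod_closed.

Definition H2 : Type := @Quotient.quot cycles2 boundary2.
HB.instance Definition _ := GRing.Zmodule.on H2.

Lemma bar_d2_d3 b : bar_d2 (bar_d3 b) = 0.
Proof.
have d2B : zmod_morphism bar_d2 by exact: lift_is_additive.
have d20 : bar_d2 0 = 0 by rewrite -(subrr 0) d2B subrr.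
have d2N x : bar_d2 (- x) = - bar_d2 x by rewrite -sub0r d2B d20 sub0r.
have d2D x y : bar_d2 (x + y) = bar_d2 x + bar_d2 y.
  by rewrite -{1}[y]opprK d2B d2N opprK.
have d2g g h : bar_d2 << (g, h) >> = << h >> - << (g * h)%g >> + << g >>.
  by rewrite /bar_d2 liftU scale1r.
have d2Z (n : int) x : bar_d2 (n *: x) = n *: bar_d2 x.
  rewrite -[n]intz !scaler_int.
  have nat m : bar_d2 (x *+ m) = bar_d2 x *+ m.
    by elim: m => [|m IH]; rewrite ?mulr0n ?d20 // !mulrS d2D IH.
  by case: n => m; rewrite ?NegzE ?mulrNz -?pmulrn ?d2N nat.
have d3B : zmod_morphism bar_d3 by exact: lift_is_additive.
have d30 : bar_d3 0 = 0 by rewrite -(subrr 0) d3B subrr.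
have d3D x y : bar_d3 (x + y) = bar_d3 x + bar_d3 y.
  by rewrite -{1}[y]opprK d3B -[- y]sub0r d3B d30 sub0r opprK.
elim/freeg_ind_dom0: b => [|c [[g h] k] b _ _ IH]; first by rewrite d30 d20.
rewrite d3D d2D IH addr0 /bar_d3 liftU d2Z.
rewrite !(d2D, d2N) !d2g mulgA.
apply/eqP/freeg_eqP => x.
rewrite (_ : _ + _ = 0) ?scaler0 //; apply/eqP/freeg_eqP => y.
by rewrite !(coeffD, coeffN) coeff0; ring.
Qed.

End SecondHomology.

Section Symplectic.

Variables (R : comPzRingType) (l : nat).

(* (false, k) stands for the index k + 1 and (true, k) for -(k + 1).          *)
Definition idx : finType := (bool * 'I_l)%type.
Implicit Types (i j h k : idx) (a b : R).

Definition iopp i : idx := (~~ i.1, i.2).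
Definition sgn i : R := if i.1 then -1 else 1.

Definition vec : lmodType R := {ffun idx -> R^o}.
Implicit Types u v w : vec.

Definition bvec i : vec := [ffun k => (k == i)%:R].

Definition sform v w : R := \sum_i sgn i * v i * w (iopp i).

Lemma iopp_neq i : i != iopp i.
Proof. by case: i => b k; rewrite xpair_eqE; case: b. Qed.

Lemma ioppK : involutive iopp.
Proof. by case=> b k; rewrite /iopp negbK. Qed.

Lemma iopp_eq i j : (iopp i == iopp j) = (i == j).
Proof. exact/inj_eq/can_inj/ioppK. Qed.

Lemma iopp_eqr i j : (iopp i == j) = (i == iopp j).
Proof. by rewrite -{1}[j]ioppK iopp_eq. Qed.

Lemma sgn_opp i : sgn (iopp i) = - sgn i.
Proof. by case: i => [[]] k; rewrite /sgn /= ?opprK. Qed.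

Lemma sgn_sqr i : sgn i * sgn i = 1.
Proof. by rewrite /sgn; case: ifP; rewrite ?mulrNN mulr1. Qed.

Lemma sform_bvecl i w : sform (bvec i) w = sgn i * w (iopp i).
Proof.
rewrite /sform (bigD1 i) //= ffunE eqxx mulr1 big1 ?addr0 // => j /negPf ji.
by rewrite ffunE ji mulr0 mul0r.
Qed.

Lemma sform_bvec i j : sform (bvec i) (bvec j) = sgn i * (i == iopp j)%:R.
Proof. by rewrite sform_bvecl ffunE iopp_eqr. Qed.

Lemma sformDl u v w : sform (u + v) w = sform u w + sform v w.
Proof.
by rewrite -big_split /=; apply: eq_bigr => i _; rewrite ffunE; ring.
Qed.

Lemma sformDr u v w : sform u (v + w) = sform u v + sform u w.
Proof.
by rewrite -big_split /=; apply: eq_bigr => i _; rewrite ffunE; ring.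
Qed.

Lemma sformZl a v w : sform (a *: v) w = a * sform v w.
Proof.
rewrite mulr_sumr; apply: eq_bigr => i _; rewrite ffunE.
by rewrite -[(a *: v i)]/(a * v i); ring.
Qed.

Lemma sformZr a v w : sform v (a *: w) = a * sform v w.
Proof.
rewrite mulr_sumr; apply: eq_bigr => i _; rewrite ffunE.
by rewrite -[(a *: w _)]/(a * w _); ring.
Qed.

Lemma sformC v w : sform w v = - sform v w.
Proof.
rewrite /sform (reindex_inj (can_inj ioppK)) -sumrN /=; apply: eq_bigr => i _.
by rewrite sgn_opp ioppK; ring.
Qed.

Lemma sformvv v : sform v v = 0.
Proof.
rewrite /sform (bigID (fun i : idx => i.1)) /= addrC.
rewrite (reindex_inj (can_inj ioppK)) /=; under eq_bigl do rewrite negbK.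
rewrite -big_split big1 //= => i _.
by rewrite sgn_opp ioppK; ring.
Qed.

Definition is_symplectic (g : vec -> vec) : Prop :=
  [/\ linear g, bijective g & forall v w, sform (g v) (g w) = sform v w].

Record Sp := MkSp { sp_fun :> vec -> vec; sp_funP : `[< is_symplectic sp_fun >] }.

HB.instance Definition _ := [isSub for sp_fun].
HB.instance Definition _ := [Choice of Sp by <:].

Lemma sp_ext (g h : Sp) : (forall w, g w = h w) -> g = h.
Proof. by move=> gh; apply/val_inj/funext. Qed.

Definition mk_sp (g : vec -> vec) (gP : is_symplectic g) : Sp :=
  MkSp (asboolT gP).

Lemma id_symplectic : is_symplectic id.
Proof. by split=> //; exists id. Qed.

Lemma comp_symplectic (g h : Sp) : is_symplectic (g \o h).
Proof.
case: g h => [g /= /asboolP[gl gb gf]] [h /= /asboolP[hl hb hf]].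
split; last by move=> v w /=; rewrite gf hf.
  by move=> a v w /=; rewrite hl gl.
exact: bij_comp.
Qed.

Lemma inv_symplectic (g : Sp) : {h : vec -> vec |
  [/\ is_symplectic h, cancel g h & cancel h g]}.
Proof.
case: g => [g /= /asboolP[gl gb gf]]; apply: cid.
case: (gb) => h gK hK; exists h; split=> //; split.
- by move=> a v w; apply: (can_inj gK); rewrite gl !hK.
- by exists g.
- by move=> v w; rewrite -gf !hK.
Qed.

Definition sp_one : Sp := mk_sp id_symplectic.
Definition sp_mul (g h : Sp) : Sp := mk_sp (comp_symplectic g h).
Definition sp_inv (g : Sp) : Sp :=
  let: exist _ hP := inv_symplectic g in let: And3 hS _ _ := hP in mk_sp hS.

Lemma sp_mulA : associative sp_mul.
Proof. by move=> f g h; apply: sp_ext. Qed.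
Lemma sp_mul1 : left_id sp_one sp_mul.
Proof. by move=> g; apply: sp_ext. Qed.
Lemma sp_1mul : right_id sp_one sp_mul.
Proof. by move=> g; apply: sp_ext. Qed.
Lemma sp_mulV : left_inverse sp_one sp_inv sp_mul.
Proof.
move=> g; apply: sp_ext => w; rewrite /sp_inv.
by case: inv_symplectic => h [hS gK hK] /=; exact: gK.
Qed.
Lemma sp_Vmul : right_inverse sp_one sp_inv sp_mul.
Proof.
move=> g; apply: sp_ext => w; rewrite /sp_inv.
by case: inv_symplectic => h [hS gK hK] /=; exact: hK.
Qed.

HB.instance Definition _ := isGroup.Build Sp
  sp_mulA sp_mul1 sp_1mul sp_mulV sp_Vmul.

(* T(u, v, a); it lies in Sp when <u, v> = 0. As R is commutative, the right  *)
(* R-module structure of V is written as a left one.                          *)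
Definition transv u v a (w : vec) : vec :=
  w + (sform v w + a * sform u w) *: u + sform u w *: v.

Lemma transv_symplectic u v a : sform u v = 0 -> is_symplectic (transv u v a).
Proof.
move=> uv; have vu : sform v u = 0 by rewrite sformC uv oppr0.
have uT v' b w : sform u v' = 0 -> sform u (transv u v' b w) = sform u w.
  by move=> uv'; rewrite !(sformDr, sformZr) sformvv uv'; ring.
have vT b v' w : sform v v' = 0 -> sform v (transv u v' b w) = sform v w.
  by move=> vv'; rewrite !(sformDr, sformZr) vu vv'; ring.
have uNv : sform u (- v) = 0 by rewrite -scaleN1r sformZr uv mulr0.
have vNv : sform v (- v) = 0 by rewrite -scaleN1r sformZr sformvv mulr0.
have NvE w : sform (- v) w = - sform v w by rewrite -scaleN1r sformZl mulN1r.
split.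
- move=> c w w'; apply/ffunP => k; rewrite /transv !(sformDr, sformZr) !ffunE.
  rewrite /GRing.scale /=; ring.
- have TE c y w : transv u y c w =
    w + (sform y w + c * sform u w) *: u + sform u w *: y by [].
  exists (transv u (- v) (- a)) => w.
    rewrite TE NvE uT // vT ?sformvv // TE.
    by apply/ffunP => k; rewrite !ffunE /GRing.scale /=; ring.
  rewrite TE uT // vT // TE NvE.
  by apply/ffunP => k; rewrite !ffunE /GRing.scale /=; ring.
- move=> w w'; rewrite /transv !(sformDr, sformDl, sformZr, sformZl).
  rewrite !sformvv uv vu (sformC u w) (sformC v w); ring.
Qed.

(* T_ij(a), for any i != j including j = -i.                                  *)
Definition Tfun i j a : vec -> vec :=
  if j == iopp i then transv (bvec i) 0 a
  else transv (bvec i) ((a * sgn (iopp j)) *: bvec (iopp j)) 0.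

Lemma Tfun_symplectic i j (ij : i != j) a : is_symplectic (Tfun i j a).
Proof.
rewrite /Tfun; case: ifP => _; apply: transv_symplectic.
  by rewrite -(scale0r 0) sformZr mul0r.
by rewrite sformZr sform_bvec ioppK (negPf ij) !mulr0.
Qed.

Definition T i j (ij : i != j) a : Sp := mk_sp (Tfun_symplectic ij a).

Definition is_T (g : Sp) : Prop :=
  exists i j (ij : i != j) a, g = T ij a.

Definition in_Ep : pred Sp := fun g => `[< generated is_T g >].

Record Ep := MkEp { ep_val :> Sp; ep_valP : in_Ep ep_val }.

HB.instance Definition _ := [isSub for ep_val].
HB.instance Definition _ := [Choice of Ep by <:].
HB.instance Definition _ := SubChoice_isSubGroup.Build Sp in_Ep Ep
  (generated_group_closed is_T).

Lemma T_in_Ep i j (ij : i != j) a : in_Ep (T ij a).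
Proof. by apply/asboolP/gen_in; exists i, j, ij, a. Qed.

Definition EpT i j (ij : i != j) a : Ep := MkEp (T_in_Ep ij a).

Record stgen := STGen {
  st_i : idx; st_j : idx; st_neq : st_i != st_j; st_a : R }.

Definition Xt i j (ij : i != j) a : gterm stgen := tgen (STGen ij a).

(* In each relation the inequality proofs that are arguments of Xt express    *)
(* that the symbols occurring in it are defined.                              *)
Inductive st_rel : gterm stgen -> gterm stgen -> Prop :=
| st_R0 i j (ij : i != j) (ji : iopp j != iopp i) a :
    st_rel (Xt ij a) (Xt ji (- (a * sgn i * sgn j)))
| st_R1 i j (ij : i != j) a b :
    st_rel (tmul (Xt ij a) (Xt ij b)) (Xt ij (a + b))
| st_R2 i j h k (ij : i != j) (hk : h != k) a b :
    h != j -> h != iopp i -> k != i -> k != iopp j ->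
    st_rel (tcomm (Xt ij a) (Xt hk b)) tone
| st_R3 i j k (ij : i != j) (jk : j != k) (ik : i != k) a b :
    i != iopp j -> i != iopp k -> j != iopp k ->
    st_rel (tcomm (Xt ij a) (Xt jk b)) (Xt ik (a * b))
| st_R4 i j (ii : i != iopp i) (ij' : iopp i != j) (ij : i != j)
    (jj : iopp j != j) a b :
    st_rel (tcomm (Xt ii a) (Xt ij' b))
           (tmul (Xt ij (a * b * sgn i)) (Xt jj (- (a * b ^+ 2))))
| st_R5 i j (ij : i != j) (ji : j != iopp i) (ii : i != iopp i) a b :
    st_rel (tcomm (Xt ij a) (Xt ji b)) (Xt ii (2%:R * a * b * sgn i)).

Definition StSp : Type := presented st_rel.
HB.instance Definition _ := Group.on StSp.

Definition X i j (ij : i != j) a : StSp := pres_gen st_rel (STGen ij a).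

Lemma Tshort i (ii : i != iopp i) a w k :
  T ii a w k = w k + a * sgn i * w (iopp i) * (k == i)%:R.
Proof.
rewrite /= /Tfun eqxx /transv !ffunE /GRing.scale /= sform_bvecl.
rewrite -[X in sform X w](scale0r (0 : vec)) sformZl; ring.
Qed.

Lemma Tlong i j (ij : i != j) a w k : j != iopp i ->
  T ij a w k = w k + a * w j * (k == i)%:R
                   - a * sgn i * sgn j * w (iopp i) * (k == iopp j)%:R.
Proof.
move=> /negPf ji; rewrite /= /Tfun ji.
rewrite /transv sformZl !sform_bvecl ioppK sgn_opp !ffunE /GRing.scale /=.
have /(congr1 (fun x => a * w j * (k == i)%:R * x)) := sgn_sqr j.
rewrite mulr1 => <-; ring.
Qed.

Lemma Tneg i j (ij : i != j) (ji : iopp j != iopp i) a :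
  T ij a = T ji (- (a * sgn i * sgn j)).
Proof.
case: (eqVneq j (iopp i)) => [e|ji'].
  subst j; have -> b : T ji b = T ij b.
    by apply: sp_ext => w; rewrite /= /Tfun !ioppK.
  by rewrite sgn_opp mulrN opprK -[a * _ * _]mulrA sgn_sqr mulr1.
apply: sp_ext => w; apply/ffunP => k.
rewrite !Tlong ?ioppK //; last by rewrite eq_sym.
rewrite !sgn_opp.
have ei := sgn_sqr i; have ej := sgn_sqr j.
transitivity (w k + a * (sgn i * sgn i) * (sgn j * sgn j) * w j * (k == i)%:R
  - a * sgn i * sgn j * w (iopp i) * (k == iopp j)%:R); last by ring.
by rewrite ei ej !mulr1.
Qed.

Lemma iopp_neqF i : (i == iopp i) = false.
Proof. exact: negPf (iopp_neq i). Qed.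

(* Decides the equalities between the indices i, -i, j, ... occurring in the  *)
(* goal by means of the disequalities in the context.                         *)
Ltac idx_simp :=
  rewrite ?ioppK ?iopp_eq ?iopp_eqr ?ioppK ?iopp_neqF ?eqxx;
  repeat match goal with
  | H : is_true (~~ (?x == ?y)) |- _ => progress rewrite !(negPf H)
  | H : is_true (~~ (?x == ?y)) |- _ =>
      let e := fresh in
      have e := negPf H; rewrite eq_sym ?iopp_eqr in e; progress rewrite !e;
      clear e
  end;
  rewrite ?sgn_opp ?[nat_of_bool true]/= ?[nat_of_bool false]/= ?mulr0n ?mulr1n.

Lemma TM i j (ij : i != j) a b : (T ij a * T ij b)%g = T ij (a + b).
Proof.
apply: sp_ext => w; apply/ffunP => p /=; rewrite -![Tfun i j _]/(sp_fun (T ij _)).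
case: (eqVneq j (iopp i)) => [e|ji].
  subst j; rewrite !Tshort; idx_simp; ring.
rewrite !Tlong //; idx_simp; ring.
Qed.

Lemma TR3 i j k (ij : i != j) (jk : j != k) (ik : i != k) a b :
  i != iopp j -> i != iopp k -> j != iopp k ->
  (T ij a * T jk b = T ik (a * b) * (T jk b * T ij a))%g.
Proof.
move=> nij nik njk; apply: sp_ext => w; apply/ffunP => p.
change (T ij a (T jk b w) p = T ik (a * b) (T jk b (T ij a w)) p).
have nji : j != iopp i by rewrite eq_sym iopp_eqr.
have nki : k != iopp i by rewrite eq_sym iopp_eqr.
have nkj : k != iopp j by rewrite eq_sym iopp_eqr.
rewrite !Tlong //; idx_simp.
ring: (sgn_sqr j).
Qed.

Lemma TR4 i j (ii : i != iopp i) (ij' : iopp i != j) (ij : i != j)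
    (jj : iopp j != j) a b :
  (T ii a * T ij' b =
   T ij (a * b * sgn i) * T jj (- (a * b ^+ 2)) * (T ij' b * T ii a))%g.
Proof.
have nij : i != iopp j by rewrite -iopp_eqr.
have nji : j != iopp i by rewrite eq_sym.
apply: sp_ext => w; apply/ffunP => p.
change (T ii a (T ij' b w) p =
  T ij (a * b * sgn i) (T jj (- (a * b ^+ 2)) (T ij' b (T ii a w))) p).
have nji' : j != iopp (iopp i) by rewrite ioppK eq_sym.
have Tjj c v q : T jj c v q = v q - c * sgn j * v j * (q == iopp j)%:R.
  rewrite /= /Tfun ioppK eqxx /transv !ffunE /GRing.scale /= sform_bvecl.
  rewrite -[X in sform X v](scale0r (0 : vec)) sformZl sgn_opp ioppK; ring.
rewrite !(Tlong ij _ _ _ nji, Tlong ij' _ _ _ nji', Tjj, Tshort).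
idx_simp.
ring: (sgn_sqr i) (sgn_sqr j).
Qed.

Lemma TR5 i j (ij : i != j) (ji : j != iopp i) (ii : i != iopp i) a b :
  (T ij a * T ji b = T ii (2%:R * a * b * sgn i) * (T ji b * T ij a))%g.
Proof.
have nij : i != iopp j by rewrite eq_sym iopp_eqr in ji.
apply: sp_ext => w; apply/ffunP => p.
change (T ij a (T ji b w) p =
   T ii (2%:R * a * b * sgn i) (T ji b (T ij a w)) p).
have nij' : iopp i != iopp j by rewrite iopp_eq.
rewrite !(Tlong ij _ _ _ ji, Tlong ji _ _ _ nij', Tshort).
idx_simp.
ring: (sgn_sqr i) (sgn_sqr j).
Qed.

Lemma TR2 i j h k (ij : i != j) (hk : h != k) a b :
  h != j -> h != iopp i -> k != i -> k != iopp j ->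
  (T ij a * T hk b = T hk b * T ij a)%g.
Proof.
move=> hj hi ki kj; apply: sp_ext => w; apply/ffunP => p.
change (T ij a (T hk b w) p = T hk b (T ij a w) p).
case: (eqVneq j (iopp i)) => [e|ji]; case: (eqVneq k (iopp h)) => [e'|kh].
- by subst j k; rewrite !Tshort; idx_simp; ring.
- by subst j; rewrite !(Tshort ij, Tlong hk _ _ _ kh); idx_simp; ring.
- by subst k; rewrite !(Tshort hk, Tlong ij _ _ _ ji); idx_simp; ring.
- by rewrite !Tlong //; idx_simp; ring.
Qed.

Lemma commE (G : groupType) (x y z : G) :
  (x * y = z * (y * x))%g -> (x * y * x^-1 * y^-1 = z)%g.
Proof. by move=> ->; rewrite -!mulgA mulVKg mulgV mulg1. Qed.

Definition phi_gen (x : stgen) : Ep := EpT (st_neq x) (st_a x).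

Lemma phi_gen_rel x y : st_rel x y -> geval phi_gen x = geval phi_gen y.
Proof.
case=> {x y} *; apply: val_inj.
- exact: Tneg.
- exact: TM.
- apply: commE; rewrite mul1g; exact: TR2.
- apply: commE; exact: TR3.
- apply: commE; exact: TR4.
- apply: commE; exact: TR5.
Qed.

(* X_ij(a) |-> T_ij(a), see phi_X below.                                      *)
Definition phi : StSp -> Ep := pres_lift phi_gen.

Lemma phiF : {morph phi : x y / (x / y)%g}.
Proof.
have phiM : {morph phi : x y / (x * y)%g} by exact: pres_liftM phi_gen_rel.
move=> x y; apply: (@mulIg _ (phi y)).
by rewrite -phiM !mulgVK.
Qed.

HB.instance Definition _ := isGroupMorphism.Build StSp Ep phi phiF.

Lemma phi_X i j (ij : i != j) a : phi (X ij a) = EpT ij a.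
Proof. exact: pres_lift_gen phi_gen_rel _. Qed.

Lemma phi_surj (g : Ep) : exists x, phi x = g.
Proof.
have phiP (h : Sp) : generated is_T h -> exists x, phi x = h :> Sp.
  elim=> {h} [|h [i [j [ij [a ->]]]]|h k _ [x <-] _ [y <-]|h _ [x <-]].
  - by exists 1%g; rewrite gmulf1.
  - by exists (X ij a); rewrite phi_X.
  - by exists (x * y)%g; rewrite gmulfM.
  - by exists (x^-1)%g; rewrite gmulfV.
have /asboolP/phiP[x xg] := ep_valP g.
by exists x; apply: val_inj.
Qed.

Definition in_K2Sp : pred StSp := fun x => phi x == 1%g.

Record K2Sp := MkK2Sp { k2_val :> StSp; k2_valP : in_K2Sp k2_val }.

Lemma in_K2Sp_group_closed : group_closed in_K2Sp.
Proof.
split=> [|x y]; rewrite !unfold_in /in_K2Sp ?gmulf1 // => /eqP hx /eqP hy.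
by rewrite phiF hx hy mulgV.
Qed.

HB.instance Definition _ := [isSub for k2_val].
HB.instance Definition _ := [Choice of K2Sp by <:].
HB.instance Definition _ := SubChoice_isSubGroup.Build StSp in_K2Sp K2Sp
  in_K2Sp_group_closed.

End Symplectic.

(* Main.v *)
Require Import Defs.
From mathcomp Require Import all_boot all_order all_algebra.
From HB Require Import structures.
From mathcomp Require Import boolp ring freeg.
Import Defs.

Set Implicit Arguments.
Unset Strict Implicit.
Unset Printing Implicit Defensive.

Import GRing.Theory.
Local Open Scope ring_scope.
Local Open Scope quotient_scope.

(** Three facts about phi : StSp -> Ep combine.

    - StSp is perfect: short root elements are commutators by R3, and long
      ones are obtained from R4 ([St_perfect]).
    - Every central extension E of Ep receives a morphism from StSp over Ep
      ([St_lift]).  A commutator of lifts to E depends only on the elements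
      lifted, so commutators provide canonical lifts of the root elements; that
      these satisfy R0-R5 follows from identities of Hall-Witt type, for which
      l >= 4 leaves enough auxiliary indices.
    - The kernel of phi is central ([ker_central]).

    Given these, take for E the extension of Ep by the group A of 2-chains modulo
    boundaries whose cocycle is tautological.  The morphism psi : StSp -> E
    restricts on the kernel of phi, up to a constant, to an additive map into A.
    Its values are cycles, because StSp is perfect and the boundary d2 extends to
    a morphism from E to a commutative group.  Conversely a section of phi gives a
    cocycle with values in the kernel, hence an additive map from A to the kernel,
    and the two maps induce mutually inverse bijections between the kernel and
    the cycles modulo boundaries ([schurM], [schur_bij]).

    Centrality is the main point.  It suffices to define for all vectors u an
    element of StSp lifting T(u, 0, a), equal to X_{i,-i}(a) for u = e_i, in
    such a way that g in StSp conjugates the lift for u to the lift for phi(g) u: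
    an element of the kernel then commutes with all X_{i,-i}(a), and with the
    other generators by R4.  Write V_i for the span of the e_k with k distinct
    from i and -i.  The elements X_{ik} generate a Heisenberg group with
    elements x_i(v, a), v in V_i, on which the X_{hk} with h, k distinct from i
    and -i act as they should ([levi_shortX], [levi_longX]).
    For v in V_i one sets
      Z_i(v, a) = x_{-i}(v) X_{i,-i}(a) x_{-i}(v)^-1 x_i(eps_i a v, -a),
    the formula being imposed by its image in Sp.  If v lies also in V_j, then
    Z_i(v, a) = Z_j(v, a) ([liftT_indep]).  A general u is split as s + v with s in
    the span of e_i and e_{-i} and v in V_i, and T(u, 0, a) is lifted to
    Z(s, a) Y_i(a s, v) Z_i(v, a), where Y_i(s, v) lifts T(s, v, 0)
    ([fullT]).  By construction this lift is compatible with the generators X_{hk}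
    whose indices avoid i and -i.  Splitting u along two planes shows that it
    does not depend on i ([fullT_indep]).  So it is compatible with all
    generators. *)

(** * Commutators in groups *)

Section Commutators.
Variable G : groupType.
Implicit Types x y z : G.

(** The Steinberg relations use the convention x y x^-1 y^-1, opposite to that of
    [~ x, y].  The definition is locked because associativity would otherwise
    rewrite inside it. *)
Fact lcomm_key : unit. Proof. exact: tt. Qed.
Definition lcomm x y : G := locked_with lcomm_key (x * y * x^-1 * y^-1)%g.
Lemma lcommE x y : lcomm x y = (x * y * x^-1 * y^-1)%g.
Proof. by rewrite /lcomm unlock. Qed.
Definition lconj x y : G := (x * y * x^-1)%g.

Lemma lconjM x y z : lconj x (y * z)%g = (lconj x y * lconj x z)%g.
Proof. by rewrite /lconj !mulgA mulgVK. Qed.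
Lemma lconj1 x : lconj x 1%g = 1%g. Proof. by rewrite /lconj mulg1 mulgV. Qed.
Lemma lconjV x y : lconj x y^-1%g = (lconj x y)^-1%g.
Proof. by rewrite /lconj !invgM invgK !mulgA. Qed.
Lemma lconjMl x y z : lconj (x * y)%g z = lconj x (lconj y z).
Proof. by rewrite /lconj invgM !mulgA. Qed.
Lemma lconjK x : cancel (lconj x) (lconj x^-1%g).
Proof. by move=> y; rewrite /lconj invgK !mulgA mulVg mul1g mulgVK. Qed.
Lemma mul_lconj x y : (x * y)%g = (lconj x y * x)%g.
Proof. by rewrite /lconj mulgVK. Qed.
Lemma lconj_fix x y : commute x y -> lconj x y = y.
Proof. by move=> xy; rewrite /lconj xy mulgK. Qed.
Lemma lconj_commute x y : lconj x y = y -> commute x y.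
Proof. by move=> xy; rewrite /commute mul_lconj xy. Qed.
Lemma lcomm_lconj x y : lcomm x y = (lconj x y * y^-1)%g. Proof. exact: lcommE. Qed.
Lemma lconj_lcomm x y : lconj x y = (lcomm x y * y)%g.
Proof. by rewrite lcommE mulgVK. Qed.
Lemma lcomm1P x y : lcomm x y = 1%g <-> commute x y.
Proof.
split=> [h|h]; last by rewrite lcommE h mulgK mulgV.
by apply: lconj_commute; rewrite lconj_lcomm h mul1g.
Qed.
Lemma lcommV x y : (lcomm x y)^-1%g = lcomm y x.
Proof. by rewrite !lcommE !invgM !invgK !mulgA. Qed.
Lemma lcommMl x y z : lcomm (x * y)%g z = (lconj x (lcomm y z) * lcomm x z)%g.
Proof. by rewrite !lcommE /lconj invgM !mulgA !mulgVK. Qed.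
Lemma lcommMr x y z : lcomm x (y * z)%g = (lcomm x y * lconj y (lcomm x z))%g.
Proof. by rewrite !lcommE /lconj invgM !mulgA !mulgVK. Qed.
Lemma lconjR x y z : lconj x (lcomm y z) = lcomm (lconj x y) (lconj x z).
Proof. by rewrite !lcommE !lconjM !lconjV. Qed.
Lemma commuteVl x y : commute x y -> commute x^-1%g y.
Proof. by move=> h; apply/commute_sym/commuteV/commute_sym. Qed.
End Commutators.

(** * Generators and relations of the Steinberg group *)

Section Generators.
Variables (R : comPzRingType) (l : nat).
Local Notation St := (StSp R l).
Local Notation idx := (idx l).
Local Notation sg := (@sgn R l).
Implicit Types (i j h k m : idx) (a b c : R).

(** The generator X_ij(a) extended by 1 to the diagonal, so that statements need
    not carry proofs of i != j. *)
Definition stX i j a : St :=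
  if @idP (i != j) is ReflectT h then X h a else 1%g.

Lemma stXE i j (ij : i != j) a : stX i j a = X ij a.
Proof.
rewrite /stX; case: {-}_ / idP => [h|/(_ ij)//].
by rewrite (bool_irrelevance h ij).
Qed.

Definition St_class (t : gterm (stgen R l)) : St :=
  \pi_(presented (@st_rel R l)) t.

Lemma St_rel t u : st_rel t u -> St_class t = St_class u.
Proof. by move=> h; apply/pres_eqP/pc_rel. Qed.

Lemma St_classM t u : St_class (tmul t u) = (St_class t * St_class u)%g.
Proof. by rewrite /St_class -pres_mulE. Qed.

Lemma St_classV t : St_class (tinv t) = (St_class t)^-1%g.
Proof. by rewrite /St_class -pres_invE. Qed.

Lemma St_classR t u :
  St_class (tcomm t u) = lcomm (St_class t) (St_class u).
Proof. by rewrite lcommE /tcomm !St_classM !St_classV. Qed.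

Lemma plane_neq i j : i.2 != j.2 -> i != j.
Proof. by apply: contraNneq => ->. Qed.

Lemma stX_R0 i j a : i != j -> stX i j a = stX (iopp j) (iopp i) (- (a * sg i * sg j)).
Proof.
move=> ij; have ji : iopp j != iopp i by rewrite iopp_eq eq_sym.
by rewrite !stXE; apply/St_rel/st_R0.
Qed.

Lemma stX_R1 i j a b : i != j -> (stX i j a * stX i j b)%g = stX i j (a + b).
Proof. by move=> ij; rewrite !stXE -[LHS]St_classM; apply/St_rel/st_R1. Qed.

Lemma stX_R2 i j h k a b : i != j -> h != k ->
  h != j -> h != iopp i -> k != i -> k != iopp j ->
  lcomm (stX i j a) (stX h k b) = 1%g.
Proof.
move=> ij hk *; rewrite !stXE -[LHS]St_classR -[RHS]/(St_class tone).
exact/St_rel/st_R2.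
Qed.

Lemma plane_neq3 i j : i.2 != j.2 -> 
  [/\ i != j, i != iopp j, iopp i != j & iopp i != iopp j].
Proof. by split; apply: plane_neq. Qed.

Lemma stX_R3 i j k a b : i.2 != j.2 -> j.2 != k.2 -> i.2 != k.2 ->
  lcomm (stX i j a) (stX j k b) = stX i k (a * b).
Proof.
move=> /plane_neq3[? ? ? ?] /plane_neq3[? ? ? ?] /plane_neq3[? ? ? ?].
rewrite !stXE // -[LHS]St_classR; exact/St_rel/st_R3.
Qed.

Lemma stX_R4 i j a b : i.2 != j.2 ->
  lcomm (stX i (iopp i) a) (stX (iopp i) j b) =
  (stX i j (a * b * sg i) * stX (iopp j) j (- (a * b ^+ 2)))%g.
Proof.
move=> /plane_neq3[? ? ? ?]; have jj : iopp j != j by rewrite eq_sym iopp_neq.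
rewrite !stXE ?iopp_neq // => *.
by rewrite -[LHS]St_classR -[RHS]St_classM; exact/St_rel/st_R4.
Qed.

Lemma stX_R5 i j a b : i.2 != j.2 ->
  lcomm (stX i j a) (stX j (iopp i) b) = stX i (iopp i) (2%:R * a * b * sg i).
Proof.
move=> /plane_neq3[? ? ? ?]; have ji : j != iopp i by rewrite eq_sym.
rewrite !stXE ?iopp_neq // => *.
by rewrite -[LHS]St_classR; exact/St_rel/st_R5.
Qed.

Lemma stX_diag i a : stX i i a = 1%g.
Proof. by rewrite /stX; case: {-}_ / idP => // h; exfalso; move: h; rewrite eqxx. Qed.

Lemma stX0 i j : stX i j 0 = 1%g.
Proof.
case: (eqVneq i j) => [->|ij]; first exact: stX_diag.
by apply: (@mulgI _ (stX i j 0)); rewrite stX_R1 // addr0 mulg1.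
Qed.

Lemma St_ind (P : St -> Prop) :
  (forall x y, P x -> P y -> P (x * y)%g) -> (forall x, P x -> P x^-1%g) ->
  (forall i j a, i != j -> P (stX i j a)) -> P 1%g -> forall x, P x.
Proof.
move=> PM PV Pst P1; elim/quotW => t; rewrite -/(St_class t); elim: t => [|[i j ij a]|t IHt u IHu|t IHt].
- exact: P1.
- by rewrite -[St_class _]/(X ij a) -stXE; apply: Pst.
- by rewrite St_classM; apply: PM.
- by rewrite St_classV; apply: PV.
Qed.

Lemma plane_ex (s : seq 'I_l) : (size s < l)%N ->
  exists m : idx, all (fun p => m.2 != p) s.
Proof.
move=> sl; have [q qs] : exists q, q \notin s.
  apply/existsP; apply: contraLR sl => /existsPn ns.
  rewrite -leqNgt -[l in (l <= _)%N]card_ord.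
  rewrite (leq_trans _ (card_size s)) // subset_leq_card //.
  by apply/subsetP => q _; have /negPn -> := ns q.
exists (false, q); apply/allP => p ps /=.
by apply: contraNneq qs => ->.
Qed.

Lemma plane3 (p1 p2 p3 : 'I_l) : (4 <= l)%N ->
  exists n : idx, [/\ n.2 != p1, n.2 != p2 & n.2 != p3].
Proof.
move=> hl; have [n /and4P[? ? ? _]] := plane_ex (s := [:: p1; p2; p3]) hl.
by exists n.
Qed.

Lemma phiM x y : phi (x * y : St)%g = (phi x * phi y)%g.
Proof. exact: gmulfM. Qed.
Lemma phiV x : phi (x^-1 : St)%g = (phi x)^-1%g. Proof. exact: gmulfV. Qed.

End Generators.

(** * The tautological central extension *)

Lemma freeg_gen_ind (T : choiceType) (P : {freeg T} -> Prop) :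
  P 0 -> (forall x y, P x -> P y -> P (x + y)) -> (forall x, P x -> P (- x)) ->
  (forall t, P << t >>) -> forall x, P x.
Proof.
move=> P0 PD PN Pt; elim/freeg_ind_dom0 => [//|c t x _ _ Px]; apply: (PD) => //.
have -> : << c *g t >> = << t >> *~ c :> {freeg T} by rewrite freegU_mulz intz.
have Pn n : P (<< t >> *+ n).
  by elim: n => [|n IH]; rewrite ?mulr0n // mulrS; apply: (PD).
case: c {Px} => n; first by rewrite -pmulrn.
by rewrite NegzE mulrNz -pmulrn; apply/PN/Pn.
Qed.

Section Additive.
Variables (U V : zmodType) (f : U -> V).
Hypothesis fB : zmod_morphism f.
Lemma zmod_morphism0 : f 0 = 0. Proof. by rewrite -(subrr 0) fB subrr. Qed.
Lemma zmod_morphismN x : f (- x) = - f x. Proof. by rewrite -[- x]sub0r fB zmod_morphism0 sub0r. Qed.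
Lemma zmod_morphismD x y : f (x + y) = f x + f y.
Proof. by rewrite -{1}[y]opprK fB zmod_morphismN opprK. Qed.
End Additive.

Lemma freeg_add_ext (T : choiceType) (V : zmodType) (f g : {freeg T} -> V) :
  zmod_morphism f -> zmod_morphism g -> (forall t, f << t >> = g << t >>) -> f =1 g.
Proof.
move=> fB gB fg; elim/freeg_gen_ind => [|x y fx fy|x fx|//].
- by rewrite !zmod_morphism0.
- by rewrite !zmod_morphismD // fx fy.
- by rewrite !zmod_morphismN // fx.
Qed.

Section TautologicalExtension.
Variable G : groupType.
Implicit Types (g h k : G).

Lemma bar_d2B : zmod_morphism (@bar_d2 G). Proof. exact: lift_is_additive. Qed.
Lemma bar_d3B : zmod_morphism (@bar_d3 G). Proof. exact: lift_is_additive. Qed.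

(** All 2-chains are taken modulo boundaries, not only the cycles: additive maps
    from this quotient to an abelian group are exactly the 2-cocycles of G with
    values in that group. *)
Definition boundaries : {pred {freeg (G * G)%type}} := fun c => `[< exists b, c = bar_d3 b >].
Lemma boundaries_zmod_closed : zmod_closed boundaries.
Proof.
split=> [|x y /asboolP[b hb] /asboolP[c hc]]; apply/asboolP.
  by exists 0; rewrite (zmod_morphism0 bar_d3B).
by exists (b - c); rewrite bar_d3B -hb -hc.
Qed.
HB.instance Definition _ :=
  GRing.isZmodClosed.Build _ boundaries boundaries_zmod_closed.

Definition chain_classes : Type := @Quotient.quot {freeg (G * G)%type} boundaries.
HB.instance Definition _ := GRing.Zmodule.on chain_classes.

Definition chain_class (c : {freeg (G * G)%type}) : chain_classes := \pi_(Quotient.quot boundaries) c.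

Lemma chain_classB : zmod_morphism chain_class.
Proof. by move=> x y; rewrite /chain_class raddfB. Qed.

Lemma chain_class_eq c d : chain_class c = chain_class d <-> exists b, c - d = bar_d3 b.
Proof.
split=> [/eqP|[b cd]].
  by rewrite -Quotient.idealrBE => /asboolP.
by apply/eqP; rewrite -Quotient.idealrBE; apply/asboolP; exists b.
Qed.

Lemma chain_classK (a : chain_classes) : chain_class (repr a) = a. Proof. exact: reprK. Qed.

Definition taut g h : chain_classes := chain_class << (g, h) >>.

(** The cocycle identity says that the boundary of (g, h, k) vanishes. *)
Lemma taut_cocycle g h k : taut g h + taut (g * h)%g k = taut h k + taut g (h * k)%g.
Proof.
have : chain_class (bar_d3 << (g, h, k) >>) = 0.
  by rewrite -(zmod_morphism0 chain_classB); apply/chain_class_eq; exists << (g, h, k) >>; rewrite subr0.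
rewrite /bar_d3 liftU scale1r chain_classB (zmod_morphismD chain_classB) chain_classB => H.
by rewrite /taut; move/subr0_eq: H => <-; rewrite addrAC subrK.
Qed.

Lemma taut1g g : taut 1%g g = taut 1%g 1%g.
Proof. by have := taut_cocycle 1%g 1%g g; rewrite !mul1g => /addIr. Qed.
Lemma tautg1 g : taut g 1%g = taut 1%g 1%g.
Proof. by have := taut_cocycle g 1%g 1%g; rewrite !mulg1 => /addIr. Qed.
Lemma tautgV g : taut g g^-1%g = taut g^-1%g g.
Proof.
have := taut_cocycle g g^-1%g g; rewrite mulgV mulVg taut1g tautg1.
by move/addIr.
Qed.

Definition taut_ext : Type := (chain_classes * G)%type.
HB.instance Definition _ := Choice.on taut_ext.

Implicit Types u v w : taut_ext.
Definition taut_pair (a : chain_classes) g : taut_ext := (a, g).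
(** The cocycle [taut] is not normalised, whence the correction by taut 1 1. *)
Definition taut_ext_one : taut_ext := taut_pair (- taut 1%g 1%g) 1%g.
Definition taut_ext_mul u v : taut_ext := taut_pair (u.1 + v.1 + taut u.2 v.2) (u.2 * v.2)%g.
Definition taut_ext_inv u : taut_ext := taut_pair (- u.1 - taut u.2 u.2^-1%g - taut 1%g 1%g) u.2^-1%g.

Lemma taut_ext_mulA : associative taut_ext_mul.
Proof.
move=> [a g] [b h] [c k]; rewrite /taut_ext_mul /taut_pair /= mulgA; congr (_, _).
rewrite !addrA -!addrA; congr (_ + (_ + _)).
by rewrite addrA [RHS]addrCA taut_cocycle -addrA.
Qed.
Lemma taut_ext_mul1 : left_id taut_ext_one taut_ext_mul.
Proof.
by move=> [a g]; rewrite /taut_ext_mul /taut_pair /= mul1g taut1g [_ + a]addrC subrK.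
Qed.
Lemma taut_ext_1mul : right_id taut_ext_one taut_ext_mul.
Proof. by move=> [a g]; rewrite /taut_ext_mul /taut_pair /= mulg1 tautg1 subrK. Qed.
Lemma taut_ext_mulV : left_inverse taut_ext_one taut_ext_inv taut_ext_mul.
Proof.
move=> [a g]; rewrite /taut_ext_mul /taut_pair /taut_ext_one /taut_pair /= mulVg tautgV; congr (_, _).
by rewrite [_ + a]addrC -!addrA addNKr [X in _ + X]addrC addKr.
Qed.
Lemma taut_ext_Vmul : right_inverse taut_ext_one taut_ext_inv taut_ext_mul.
Proof.
move=> [a g]; rewrite /taut_ext_mul /taut_pair /taut_ext_one /taut_pair /= mulgV; congr (_, _).
by rewrite -!addrA addNKr [X in _ + X]addrC addKr.
Qed.
HB.instance Definition _ := isGroup.Build taut_ext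
  taut_ext_mulA taut_ext_mul1 taut_ext_1mul taut_ext_mulV taut_ext_Vmul.

Lemma taut_extM u v : (u * v)%g = taut_pair (u.1 + v.1 + taut u.2 v.2) (u.2 * v.2)%g.
Proof. by []. Qed.

Definition taut_proj (u : taut_ext) : G := u.2.
Lemma taut_projM : {morph taut_proj : u v / (u * v)%g}. Proof. by []. Qed.
Lemma taut_proj_surj g : exists u, taut_proj u = g. Proof. by exists (taut_pair 0 g). Qed.
Lemma taut_proj_central u : taut_proj u = 1%g -> forall v, commute u v.
Proof.
case: u => a g /= -> [b h]; rewrite /commute !taut_extM /= mul1g mulg1 taut1g tautg1.
by rewrite [a + b]addrC.
Qed.

Definition class_d2 (a : chain_classes) : {freeg G} := bar_d2 (repr a).
Lemma class_d2_class c : class_d2 (chain_class c) = bar_d2 c.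
Proof.
have /chain_class_eq[b e] := chain_classK (chain_class c).
apply: subr0_eq; rewrite /class_d2 -bar_d2B [repr _ - c]e.
exact: bar_d2_d3.
Qed.
Lemma class_d2B : zmod_morphism class_d2.
Proof.
by move=> a b; rewrite -[a]chain_classK -[b]chain_classK -chain_classB !class_d2_class bar_d2B.
Qed.

Lemma class_d2_taut g h : class_d2 (taut g h) = << h >> - << (g * h)%g >> + << g >>.
Proof. by rewrite class_d2_class /bar_d2 liftU scale1r. Qed.

(** As d2 (g, h) = h - gh + g measures how far g |-> << g >> is from being
    additive, adding << g >> to d2 gives a morphism to a commutative group.  It
    is trivial on the image of a perfect group. *)
Definition chi (u : taut_ext) : {freeg G} := class_d2 u.1 + << u.2 >>.
Lemma chiM u v : chi (u * v)%g = chi u + chi v.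
Proof.
rewrite /chi taut_extM /= !(zmod_morphismD class_d2B) class_d2_taut -addrA.
by rewrite [_ + << u.2 >> + _]addrAC subrK [_ + << u.2 >>]addrC addrACA.
Qed.

End TautologicalExtension.

(** * Perfect central extensions and second homology *)

Section CommutativeGroup.
Variables (K : groupType) (KC : commutative (fun x y : K => x * y)%g).
(** Additive maps out of free abelian groups need an additively written target. *)
Definition additive_of of commutative (fun x y : K => x * y)%g : Type := K.
Local Notation A := (additive_of KC).
HB.instance Definition _ := Choice.on A.
HB.instance Definition _ := GRing.isZmodule.Build A
  (@mulgA K) KC (@mul1g K) (@mulVg K).
End CommutativeGroup.

Section SchurMultiplier.
Variables (S G K : groupType) (ph : S -> G) (kv : K -> S).
Hypothesis phM : {morph ph : x y / (x * y)%g}.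
Hypothesis ph_surj : forall g, exists x, ph x = g.
Hypothesis kvM : {morph kv : x y / (x * y)%g}.
Hypothesis kv_inj : injective kv.
Hypothesis kvP : forall x, ph x = 1%g <-> exists k, kv k = x.
Hypothesis central : forall x y, ph x = 1%g -> commute x y.
Hypothesis perfect : forall P : S -> Prop, P 1%g ->
  (forall x y, P x -> P y -> P (x * y)%g) -> (forall x, P x -> P x^-1%g) ->
  (forall x y, P (lcomm x y)) -> forall x, P x.
Variable psi : S -> taut_ext G.
Hypothesis psiM : {morph psi : x y / (x * y)%g}.
Hypothesis psi_ph : forall x, taut_proj (psi x) = ph x.
Implicit Types (x y : S) (k : K) (g h : G).

Lemma morph1 (A B : groupType) (f : A -> B) : {morph f : x y / (x * y)%g} -> f 1%g = 1%g.
Proof. by move=> fM; apply: (mulgI (f 1%g)); rewrite -fM !mulg1. Qed.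
Lemma morphV (A B : groupType) (f : A -> B) : {morph f : x y / (x * y)%g} ->
  {morph f : x / x^-1%g}.
Proof. by move=> fM x; apply/esym/mulg1_eq; rewrite -fM mulgV morph1. Qed.

Lemma chi_psi x : chi (psi x) = 0.
Proof.
have c1 (u : taut_ext G) : u = 1%g -> chi u = 0.
  by move=> ->; apply: (addrI (chi (1%g : taut_ext G))); rewrite -chiM mulg1 addr0.
have cV (u : taut_ext G) : chi (u^-1%g : taut_ext G) = - chi u.
  by apply: (addrI (chi u)); rewrite -chiM (c1 _ (mulgV u)) subrr.
elim/perfect: x => [|x y cx cy|x cx|x y].
- exact/c1/morph1.
- by rewrite psiM chiM cx cy addr0.
- by rewrite (morphV psiM) cV cx oppr0.
by rewrite lcommE !psiM !(morphV psiM) !chiM !cV addrAC addrK subrr.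
Qed.

Lemma KC : commutative (fun x y : K => x * y)%g.
Proof.
move=> k k'; apply: kv_inj; rewrite !kvM; apply: central.
by apply/kvP; exists k.
Qed.

Local Notation Ka := (additive_of KC).
Local Notation "V ^z" := (zmodule V).

Definition sect g : S := sval (cid (ph_surj g)).
Lemma sectK g : ph (sect g) = g. Proof. exact: svalP (cid (ph_surj g)). Qed.

Lemma coc_ex g h : exists k, kv k = (sect g * sect h * (sect (g * h)%g)^-1)%g.
Proof. by apply/kvP; rewrite !phM (morphV phM) !sectK mulgV. Qed.
Definition coc g h : K := sval (cid (coc_ex g h)).
Lemma cocE g h : (sect g * sect h = kv (coc g h) * sect (g * h)%g)%g.
Proof. by rewrite /coc (svalP (cid (coc_ex g h))) mulgVK. Qed.

Lemma kv_commute k x : commute (kv k) x.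
Proof. by apply: central; apply/kvP; exists k. Qed.

(** Both sides compare the two ways of multiplying three values of the section. *)
Lemma coc_cocycle g h (k : G) : (coc g h * coc (g * h)%g k = coc h k * coc g (h * k)%g)%g.
Proof.
apply: kv_inj; rewrite !kvM; apply: (mulIg (sect (g * h * k)%g)).
rewrite -mulgA -cocE mulgA -cocE -[RHS]mulgA -(mulgA g h k) -cocE.
by rewrite mulgA kv_commute -[RHS]mulgA -cocE mulgA.
Qed.

Definition coc_lin : {freeg (G * G)%type} -> Ka :=
  fglift (fun x : G * G => (coc x.1 x.2 : Ka) : Ka^z).

Lemma coc_linB : zmod_morphism coc_lin.
Proof. exact: (@lift_is_additive _ _ (Ka^z)). Qed.

Lemma coc_lin1 g h : coc_lin << (g, h) >> = coc g h.
Proof. by rewrite /coc_lin liftU scale1r. Qed.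

Lemma coc_lin_d3 b : coc_lin (bar_d3 b) = 0.
Proof.
pose z0 (_ : {freeg (G * G * G)%type}) : Ka := 0.
apply: (freeg_add_ext (f := coc_lin \o @bar_d3 G) (g := z0)) => [x y|x y|[[g h] k]] /=.
- by rewrite bar_d3B coc_linB.
- by rewrite /z0 subr0.
rewrite /bar_d3 liftU scale1r coc_linB (zmod_morphismD coc_linB) coc_linB !coc_lin1.
have e : (coc g h : Ka) + coc (g * h)%g k = (coc h k : Ka) + coc g (h * k)%g.
  exact: coc_cocycle.
by rewrite -[X in X - _]addrAC -e [_ + _ - _ in X in X - _]addrK subrr.
Qed.

Definition coc_class (a : chain_classes G) : Ka := coc_lin (repr a).
Lemma coc_classE c : coc_class (chain_class c) = coc_lin c.
Proof.
have /chain_class_eq[b e] := chain_classK (chain_class c).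
by apply: subr0_eq; rewrite /coc_class -coc_linB [repr _ - c]e coc_lin_d3.
Qed.
Lemma coc_classB : zmod_morphism coc_class.
Proof. by move=> a b; rewrite -[a]chain_classK -[b]chain_classK -chain_classB !coc_classE coc_linB. Qed.

Lemma kvD (k k' : Ka) : kv (k + k') = (kv k * kv k')%g.
Proof. exact: kvM. Qed.

(** The cocycle of the section makes [taut_ext] map to S over G. *)
Definition theta (u : taut_ext G) : S := (kv (coc_class u.1) * sect u.2)%g.
Lemma thetaM : {morph theta : u v / (u * v)%g}.
Proof.
move=> u v; rewrite /theta taut_extM /= !(zmod_morphismD coc_classB) coc_classE coc_lin1.
rewrite !kvD -mulgA -cocE -!mulgA; congr (_ * _)%g.
by rewrite !mulgA kv_commute.
Qed.
Lemma ph_theta u : ph (theta u) = taut_proj u.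
Proof.
rewrite /theta phM sectK; have /kvP -> : exists k, kv k = kv (coc_class u.1) by exists (coc_class u.1).
exact: mul1g.
Qed.

(** Two morphisms over G into a central extension differ by a morphism to the
    central kernel, which is trivial on a perfect group; here they are
    theta o psi and the identity. *)
Lemma thetaK x : theta (psi x) = x.
Proof.
pose f y := theta (psi y).
have fM : {morph f : y z / (y * z)%g} by move=> y z; rewrite /f psiM thetaM.
have fc y : exists2 c, (forall z, commute c z) & f y = (c * y)%g.
  exists (f y * y^-1)%g; last by rewrite mulgVK.
  by move=> z; apply: central; rewrite phM (morphV phM) /f ph_theta psi_ph mulgV.
rewrite -/(f x); elim/perfect: x => [|x y fx fy|x fx|x y].
- exact: morph1.
- by rewrite fM fx fy.
- by rewrite (morphV fM) fx.
have [c cc fx] := fc x; have [d dc fy] := fc y.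
have -> : f (lcomm x y) = lcomm (f x) (f y) by rewrite !lcommE !fM !(morphV fM).
rewrite fx fy lcommMl (lconj_fix (cc _)).
have -> : lcomm c (d * y)%g = 1%g by apply/lcomm1P.
rewrite mulg1 lcommMr (lconj_fix (dc _)).
have dc' : commute x d by apply/commute_sym.
by rewrite ((lcomm1P x d).2 dc') mul1g.
Qed.

Lemma psi_inj : injective psi.
Proof. exact: can_inj thetaK. Qed.

(** The summand taut 1 1 turns the first component of psi, which is not additive
    because the unit of the extension is (- taut 1 1, 1), into a morphism. *)
Definition kernel_class k : chain_classes G := (psi (kv k)).1 + taut 1%g 1%g.

Lemma psi_kv k : psi (kv k) = taut_pair (kernel_class k - taut 1%g 1%g) 1%g.
Proof.
have k1 : ph (kv k) = 1%g by apply/kvP; exists k.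
rewrite /kernel_class addrK; have : (psi (kv k)).2 = 1%g by rewrite -k1 -psi_ph.
by case: (psi (kv k)) => a g /= ->.
Qed.

Lemma kernel_classM k k' : kernel_class (k * k')%g = kernel_class k + kernel_class k'.
Proof.
rewrite {1}/kernel_class kvM psiM !psi_kv taut_extM /= !addrA subrK.
by rewrite addrAC subrK.
Qed.

Lemma kernel_class_inj : injective kernel_class.
Proof. by move=> k k' e; apply/kv_inj/psi_inj; rewrite !psi_kv e. Qed.

Lemma kernel_class_cycle k : class_d2 (kernel_class k) = 0.
Proof.
have := chi_psi (kv k); rewrite psi_kv /chi /= class_d2B.
by rewrite class_d2_taut mulg1 subrr add0r subrK.
Qed.

Definition alpha g : chain_classes G := (psi (sect g)).1.
Lemma psi_sect g : psi (sect g) = taut_pair (alpha g) g.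
Proof.
have : (psi (sect g)).2 = g by rewrite -[RHS](sectK g) -psi_ph.
by rewrite /alpha; case: (psi _) => a h /= ->.
Qed.

Definition alpha_lin : {freeg G} -> chain_classes G :=
  fglift ((alpha : G -> (chain_classes G)^z)).
Lemma alpha_linB : zmod_morphism alpha_lin.
Proof. exact: (@lift_is_additive _ _ ((chain_classes G)^z)). Qed.
Lemma alpha_lin1 g : alpha_lin << g >> = alpha g.
Proof. by rewrite /alpha_lin liftU scale1r. Qed.

Lemma kernel_class_coc g h : kernel_class (coc g h) = taut g h + (alpha h - alpha (g * h)%g + alpha g).
Proof.
have := congr1 psi (cocE g h); rewrite !psiM psi_kv !psi_sect !taut_extM /= mul1g.
move=> /(congr1 fst) /=; rewrite taut1g => e; rewrite [RHS]addrAC subrK in e.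
apply: (addIr (alpha (g * h)%g)); rewrite -e -[RHS]addrA.
by rewrite [_ - _ + _ + _]addrAC subrK [RHS]addrC [alpha g + _]addrC.
Qed.

(** The maps [kernel_class] and [coc_lin] are inverse to each other up to the
    coboundary of alpha, which compares psi o sect with g |-> (0, g); on cycles
    that coboundary vanishes. *)
Lemma kernel_class_coc_lin c : kernel_class (coc_lin c) = chain_class c + alpha_lin (bar_d2 c).
Proof.
have pkB : zmod_morphism (kernel_class : Ka -> chain_classes G).
  have pkD (k k' : Ka) : kernel_class (k + k') = kernel_class k + kernel_class k' by exact: kernel_classM.
  by move=> k k'; apply: (addIr (kernel_class k')); rewrite -pkD !subrK.
apply: (freeg_add_ext (f := fun d => kernel_class (coc_lin d))
  (g := fun d => chain_class d + alpha_lin (bar_d2 d))) => [x y|x y|[g h]] /=.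
- by rewrite coc_linB pkB.
- by rewrite chain_classB bar_d2B alpha_linB opprD addrACA.
rewrite coc_lin1 kernel_class_coc /bar_d2 liftU scale1r (zmod_morphismD alpha_linB) alpha_linB.
by rewrite !alpha_lin1.
Qed.

Definition cycle_of (a : chain_classes G) : cycles2 G := insubd 0 (repr a).

Lemma class_cycle_of a : class_d2 a = 0 -> chain_class (val (cycle_of a)) = a.
Proof. by move=> a0; rewrite val_insubd /is_cycle2 -/(class_d2 a) a0 eqxx chain_classK. Qed.

Definition H2_class (z : cycles2 G) : H2 G := \pi_(Quotient.quot (@boundary2 G)) z.

Lemma H2_class_eq z z' : H2_class z = H2_class z' <-> chain_class (val z) = chain_class (val z').
Proof.
rewrite chain_class_eq; split=> [/eqP|[b zz]].
  by rewrite -Quotient.idealrBE => /asboolP.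
by apply/eqP; rewrite -Quotient.idealrBE; apply/asboolP; exists b.
Qed.

Definition schur k : H2 G := H2_class (cycle_of (kernel_class k)).

Lemma schurM k k' : schur (k * k')%g = schur k + schur k'.
Proof.
have <- : H2_class (cycle_of (kernel_class k) + cycle_of (kernel_class k')) = schur k + schur k'.
  by rewrite /H2_class raddfD.
apply/H2_class_eq; rewrite raddfD /= (zmod_morphismD (@chain_classB G)).
by rewrite !class_cycle_of ?kernel_class_cycle // kernel_classM.
Qed.

Lemma schur_bij : bijective schur.
Proof.
have inj : injective schur.
  by move=> k k' /H2_class_eq; rewrite !class_cycle_of ?kernel_class_cycle // => /kernel_class_inj.
have surj (t : H2 G) : exists k, schur k = t.
  elim/quotW: t => z; exists (coc_lin (val z)).
  apply/H2_class_eq; rewrite class_cycle_of ?kernel_class_cycle // kernel_class_coc_lin.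
  have /eqP -> : is_cycle2 (val z) by exact: cycle2_valP.
  by rewrite (zmod_morphism0 alpha_linB) addr0.
exists (fun t => sval (cid (surj t))) => [k|t]; last exact: svalP (cid (surj t)).
by apply: inj; exact: svalP (cid (surj _)).
Qed.

End SchurMultiplier.

(** * Lifting the Steinberg group to central extensions *)

Section Lifting.
Variables (R : comPzRingType) (l : nat).
Hypothesis hl : (4 <= l)%N.
Local Notation St := (StSp R l).
Local Notation idx := (idx l).
Local Notation sg := (@sgn R l).
Variables (E : groupType) (proj : E -> Ep R l).
Hypothesis projM : {morph proj : u v / (u * v)%g}.
Hypothesis proj_surj : forall g, exists u, proj u = g.
Hypothesis proj_central : forall u, proj u = 1%g -> forall v, commute u v.
Implicit Types (i j h k m n : idx) (a b c : R) (x y z : St) (u v w : E).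

Lemma proj1 : proj 1%g = 1%g.
Proof. by apply: (mulgI (proj 1%g)); rewrite -projM !mulg1. Qed.
Lemma projV u : proj u^-1%g = (proj u)^-1%g.
Proof. by apply/esym/mulg1_eq; rewrite -projM mulgV proj1. Qed.

(** Elements of E are compared with elements of StSp through their images in
    Ep, so that computations take place in StSp. *)
Definition over u x := proj u = phi x.
Lemma overM u v x y : over u x -> over v y -> over (u * v)%g (x * y)%g.
Proof. by rewrite /over projM phiM => -> ->. Qed.
Lemma overV u x : over u x -> over u^-1%g x^-1%g.
Proof. by rewrite /over projV phiV => ->. Qed.
Lemma over_lcomm u v x y : over u x -> over v y -> over (lcomm u v) (lcomm x y).
Proof. by move=> ux vy; rewrite !lcommE; apply: overM; [apply: overM; [exact: overM|exact: overV]|exact: overV]. Qed.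
Lemma over1 u : over u 1%g -> forall v, commute u v.
Proof. by rewrite /over gmulf1; apply: proj_central. Qed.

Definition some_lift x : E := sval (cid (proj_surj (phi x))).
Lemma over_some_lift x : over (some_lift x) x.
Proof. exact: svalP (cid (proj_surj (phi x))). Qed.

Definition lift_comm x y : E := lcomm (some_lift x) (some_lift y).

Lemma over_eq u v x : over u x -> over v x -> exists2 c, over c 1%g & u = (c * v)%g.
Proof.
move=> ux vx; exists (u * v^-1)%g; last by rewrite mulgVK.
by rewrite -(mulgV x); apply: overM => //; apply: overV.
Qed.

Lemma lcomm_centl (c u v : E) : (forall w, commute c w) -> lcomm (c * u)%g v = lcomm u v.
Proof.
move=> cc; rewrite lcommMl (lconj_fix (cc _)).
by have -> : lcomm c v = 1%g; [apply/lcomm1P | rewrite mulg1].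
Qed.
Lemma lcomm_centr (c u v : E) : (forall w, commute c w) -> lcomm u (c * v)%g = lcomm u v.
Proof. by move=> cc; rewrite -lcommV lcomm_centl // lcommV. Qed.

(** Two lifts differ by a central factor, which disappears in a commutator. *)
Lemma lcomm_over u v x y : over u x -> over v y -> lcomm u v = lift_comm x y.
Proof.
move=> ux vy; have [c /over1 cc ->] := over_eq ux (over_some_lift x).
have [d /over1 dc ->] := over_eq vy (over_some_lift y).
by rewrite lcomm_centl // lcomm_centr.
Qed.

Lemma over_lift_comm x y : over (lift_comm x y) (lcomm x y).
Proof. by apply: over_lcomm; apply: over_some_lift. Qed.

Lemma lift_commV x y : (lift_comm x y)^-1%g = lift_comm y x. Proof. exact: lcommV. Qed.

Definition lifts_commute x y := lift_comm x y = 1%g.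

Lemma lifts_commuteP u v x y : over u x -> over v y -> lifts_commute x y -> commute u v.
Proof. by move=> ux vy xy; apply/lcomm1P; rewrite (lcomm_over ux vy). Qed.

Lemma lifts_commute_sym x y : lifts_commute x y -> lifts_commute y x.
Proof. by move=> xy; rewrite /lifts_commute -lift_commV xy invg1. Qed.

Lemma lifts_commute_over u v x y : over u x -> over v y -> commute u v -> lifts_commute x y.
Proof. by move=> ux vy uv; rewrite /lifts_commute -(lcomm_over ux vy); apply/lcomm1P. Qed.

Lemma lifts_commuteM x y z : lifts_commute x y -> lifts_commute x z -> lifts_commute x (y * z)%g.
Proof.
move=> xy xz; apply: (lifts_commute_over (over_some_lift x) (overM (over_some_lift y) (over_some_lift z))).
by apply: commuteM; apply: lifts_commuteP; try exact: over_some_lift.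
Qed.

Lemma lifts_commuteV x y : lifts_commute x y -> lifts_commute x y^-1%g.
Proof.
move=> xy; apply: (lifts_commute_over (over_some_lift x) (overV (over_some_lift y))).
by apply: commuteV; apply: lifts_commuteP; try exact: over_some_lift.
Qed.

(** Conjugation by a lift of x multiplies lifts of y and z by central elements,
    which do not change their commutator. *)
Lemma lifts_commute_lcomm x y z : lcomm x y = 1%g -> lcomm x z = 1%g -> lifts_commute x (lcomm y z).
Proof.
move=> xy xz; apply: (lifts_commute_over (over_some_lift x) (over_lcomm (over_some_lift y) (over_some_lift z))).
apply: lconj_commute; rewrite lconjR !lconj_lcomm.
have C t : lcomm x t = 1%g -> forall w, commute (lcomm (some_lift x) (some_lift t)) w.
  by move=> xt; apply: over1; rewrite -xt; apply: over_lift_comm.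
by rewrite lcomm_centl ?lcomm_centr //; apply: C.
Qed.

Ltac neq := first [ assumption | by rewrite eq_sym | exact: iopp_neq
  | by rewrite eq_sym iopp_neq
  | by apply: plane_neq; first [assumption | by rewrite eq_sym]
  | by rewrite ?iopp_eq ?iopp_eqr ?ioppK; first [assumption | by rewrite eq_sym]
  | by rewrite eq_sym ?iopp_eq ?iopp_eqr ?ioppK; first [assumption | by rewrite eq_sym] ].

(** With an auxiliary index m one has X_ij(a) = [X_im(a), X_mj(1)], and both
    factors commute with X_hk(b). *)
Lemma lifts_commute_mid i j h k m a b : i.2 != j.2 -> h != k ->
  h != j -> h != iopp i -> k != i -> k != iopp j ->
  m.2 != i.2 -> m.2 != j.2 -> m.2 != h.2 -> m.2 != k.2 ->
  lifts_commute (stX i j a) (stX h k b).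
Proof.
move=> ij hk hj hi ki kj mi mj mh mk; apply: lifts_commute_sym.
rewrite -[a]mulr1 -(@stX_R3 R l i m j) //; try neq.
by apply: lifts_commute_lcomm; apply: stX_R2; neq.
Qed.

(** An auxiliary plane can fail to exist only when i, j, h, k lie in four distinct
    planes.  Then R4, which stays within the planes of h and k, expresses X_hk by a
    commutator and a long root element; for the latter the planes of h and k
    reduce to one. *)
Lemma lifts_commute_short i j h k a b : i.2 != j.2 -> h != k ->
  h != j -> h != iopp i -> k != i -> k != iopp j ->
  lifts_commute (stX i j a) (stX h k b).
Proof.
move=> ij hk hj hi ki kj.
have H m := @lifts_commute_mid i j h k m a b ij hk hj hi ki kj.
have [hi2|hi2] := eqVneq h.2 i.2.
  have [m [mi mj mk]] := plane3 i.2 j.2 k.2 hl.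
  by apply: (H m); rewrite // hi2.
have [hj2|hj2] := eqVneq h.2 j.2.
  have [m [mi mj mk]] := plane3 i.2 j.2 k.2 hl.
  by apply: (H m); rewrite // hj2.
have [ki2|ki2] := eqVneq k.2 i.2.
  have [m [mi mj mh]] := plane3 i.2 j.2 h.2 hl.
  by apply: (H m); rewrite // ki2.
have [kj2|kj2] := eqVneq k.2 j.2.
  have [m [mi mj mh]] := plane3 i.2 j.2 h.2 hl.
  by apply: (H m); rewrite // kj2.
have [hk2|hk2] := eqVneq h.2 k.2.
  have [m [mi mj mh]] := plane3 i.2 j.2 h.2 hl.
  by apply: (H m); rewrite // -hk2.
have [m [mi mj mk]] := plane3 i.2 j.2 k.2 hl.
have L : lifts_commute (stX i j a) (stX (iopp k) k (- (b * sg h ^+ 2))).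
  by apply: (lifts_commute_mid (m := m)) => //; neq.
have -> : stX h k b = (lcomm (stX h (iopp h) b) (stX (iopp h) k (sg h)) *
    (stX (iopp k) k (- (b * sg h ^+ 2)))^-1)%g.
  by rewrite stX_R4 // mulgK -mulrA sgn_sqr mulr1.
apply: lifts_commuteM; last exact: lifts_commuteV.
by apply: lifts_commute_lcomm; apply: stX_R2; neq.
Qed.

Lemma same_plane i j : i.2 = j.2 -> i != j -> j = iopp i.
Proof.
case: i j => [s p] [s' p'] /= <-; rewrite /iopp xpair_eqE /= eqxx andbT.
by case: s s' => [] [].
Qed.

Lemma lifts_commute_R2 i j h k a b : i != j -> h != k ->
  h != j -> h != iopp i -> k != i -> k != iopp j ->
  lifts_commute (stX i j a) (stX h k b).
Proof.
move=> ij hk hj hi ki kj.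
have [ij2|ij2] := eqVneq i.2 j.2; last exact: lifts_commute_short.
have [hk2|hk2] := eqVneq h.2 k.2; last first.
  by apply: lifts_commute_sym; apply: lifts_commute_short => //; neq.
move: hj ki kj; rewrite (same_plane ij2 ij) (same_plane hk2 hk) => hj ki kj.
have [m [mi mh _]] := plane3 i.2 h.2 h.2 hl.
have -> : stX i (iopp i) a = ((stX m (iopp i) (- a * 1 * sg m))^-1 *
    lcomm (stX m (iopp m) (- a)) (stX (iopp m) (iopp i) 1))%g.
  by rewrite stX_R4 // mulKg ioppK expr1n mulr1 opprK.
apply: lifts_commute_sym; apply: lifts_commuteM.
  by apply: lifts_commuteV; apply: lifts_commute_sym; apply: lifts_commute_short; neq.
by apply: lifts_commute_lcomm; apply: stX_R2; neq.
Qed.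

Lemma lifts_lconj u v x y : over u x -> over v y -> lifts_commute x y -> lconj u v = v.
Proof. by move=> ux vy xy; apply/lconj_fix/(lifts_commuteP ux vy xy). Qed.

Lemma mid_ex i j : exists m : idx, m.2 != i.2 /\ m.2 != j.2.
Proof. by have [m [mi mj _]] := plane3 i.2 j.2 j.2 hl; exists m. Qed.
Definition mid i j : idx := sval (cid (mid_ex i j)).
Lemma midP i j : (mid i j).2 != i.2 /\ (mid i j).2 != j.2.
Proof. exact: svalP (cid (mid_ex i j)). Qed.

(** The lifts of short root elements prescribed by R3. *)
Definition shortL i j a : E := lift_comm (stX i (mid i j) a) (stX (mid i j) j 1).

Lemma over_shortL i j a : i.2 != j.2 -> over (shortL i j a) (stX i j a).
Proof.
move=> ij; have [mi mj] := midP i j.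
have -> : stX i j a = lcomm (stX i (mid i j) a) (stX (mid i j) j 1).
  by rewrite stX_R3 ?mulr1 //; neq.
exact: over_lift_comm.
Qed.

(** Replacing X_mj(b) by [X_mh(b), X_hj(1)] and using that X_im commutes with
    X_hj, conjugation by a lift of X_im(a) only multiplies the first entry by a
    lift of X_ih(ab). *)
Lemma lift_comm_exchange i j m h a b : i.2 != j.2 -> m.2 != i.2 -> m.2 != j.2 ->
  h.2 != i.2 -> h.2 != j.2 -> m.2 != h.2 ->
  lift_comm (stX i m a) (stX m j b) = lift_comm (stX i h (a * b)) (stX h j 1).
Proof.
move=> ij mi mj hi hj mh.
pose A := some_lift (stX i m a); pose B := some_lift (stX m h b); pose C := some_lift (stX h j 1).
have oA : over A (stX i m a) := over_some_lift _.
have oB : over B (stX m h b) := over_some_lift _.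
have oC : over C (stX h j 1) := over_some_lift _.
have oBC : over (lcomm B C) (stX m j b).
  have -> : stX m j b = lcomm (stX m h b) (stX h j 1) by rewrite stX_R3 ?mulr1 //; neq.
  exact: over_lcomm.
have oAB : over (lcomm A B) (stX i h (a * b)).
  have -> : stX i h (a * b) = lcomm (stX i m a) (stX m h b) by rewrite stX_R3 //; neq.
  exact: over_lcomm.
have oABC : over (lcomm (lcomm A B) C) (stX i j (a * b)).
  have -> : stX i j (a * b) = lcomm (stX i h (a * b)) (stX h j 1) by rewrite stX_R3 ?mulr1 //; neq.
  exact: over_lcomm.
rewrite -(lcomm_over oA oBC) lcomm_lconj lconjR (lifts_lconj oA oC); last by apply: lifts_commute_R2; neq.
rewrite (lconj_lcomm A B) lcommMl (lifts_lconj oAB oBC); last by apply: lifts_commute_R2; neq.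
have -> : (lcomm B C * lcomm (lcomm A B) C = lcomm (lcomm A B) C * lcomm B C)%g.
  by apply: (lifts_commuteP oBC oABC); apply: lifts_commute_R2; neq.
by rewrite mulgK; apply: lcomm_over.
Qed.

Lemma lift_comm_short i j m a b : i.2 != j.2 -> m.2 != i.2 -> m.2 != j.2 ->
  lift_comm (stX i m a) (stX m j b) = shortL i j (a * b).
Proof.
move=> ij mi mj; have [ni nj] := midP i j.
have [h [hi hj hm]] := plane3 i.2 j.2 m.2 hl.
have mh : m.2 != h.2 by rewrite eq_sym.
have [mn|mn] := eqVneq m.2 (mid i j).2; last by rewrite (lift_comm_exchange _ _ _ mi mj ni nj).
rewrite (lift_comm_exchange _ _ ij mi mj hi hj mh) (lift_comm_exchange _ _ ij hi hj ni nj) -?mn //.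
by rewrite mulr1.
Qed.

Lemma shortLD i j a b : i.2 != j.2 -> (shortL i j a * shortL i j b)%g = shortL i j (a + b).
Proof.
move=> ij; have [m [mi mj]] := mid_ex i j.
pose H c := some_lift (stX i m c); pose C := some_lift (stX m j 1).
have oH c : over (H c) (stX i m c) := over_some_lift _.
have oC : over C (stX m j 1) := over_some_lift _.
have oHD : over (H b * H a)%g (stX i m (a + b)).
  by rewrite addrC -stX_R1; [exact: overM | neq].
have cE c : shortL i j c = lcomm (H c) C.
  by rewrite -[c in LHS]mulr1 -(lift_comm_short _ _ ij mi mj) (lcomm_over (oH c) oC).
rewrite -[(a + b)]mulr1 -(lift_comm_short _ _ ij mi mj) -(lcomm_over oHD oC) lcommMl -!cE.
rewrite (lifts_lconj (oH b) (over_shortL a ij)) //.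
by apply: lifts_commute_R2; neq.
Qed.

Lemma shortL0 i j : i.2 != j.2 -> shortL i j 0 = 1%g.
Proof. by move=> ij; apply: (mulgI (shortL i j 0)); rewrite shortLD // addr0 mulg1. Qed.

Lemma shortLN i j a : i.2 != j.2 -> shortL i j (- a) = (shortL i j a)^-1%g.
Proof. by move=> ij; apply/esym/mulg1_eq; rewrite shortLD // subrr shortL0. Qed.

Lemma shortL_R0 i j a : i.2 != j.2 -> shortL i j a = shortL (iopp j) (iopp i) (- (a * sg i * sg j)).
Proof.
move=> ij; have [m [mi mj]] := mid_ex i j.
have ji : (iopp j).2 != (iopp i).2 by rewrite eq_sym.
rewrite -[a in LHS]mulr1 -(lift_comm_short _ _ ij mi mj) -lift_commV shortLN //; congr _^-1%g.
rewrite (@stX_R0 R l m j); last by neq.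
rewrite (@stX_R0 R l i m); last by neq.
rewrite (@lift_comm_short (iopp j) (iopp i) (iopp m)) //.
by congr shortL; ring: (sgn_sqr R m).
Qed.

(** By R4 this lifts X_{m,-i}(a b eps_m) X_{i,-i}(- a b^2).  Splitting off the
    canonical lift of the first factor leaves a lift of the second, which is
    the candidate for the lift of a long root element; it remains to see that it
    depends only on i and a b^2. *)
Definition long_comm m i a b : E := lift_comm (stX m (iopp m) a) (stX (iopp m) (iopp i) b).
Fact long_part_key : unit. Proof. exact: tt. Qed.
Definition long_part m i a b : E := locked_with long_part_key
  ((shortL m (iopp i) (a * b * sg m))^-1 * long_comm m i a b)%g.
Lemma long_partE m i a b : long_part m i a b = ((shortL m (iopp i) (a * b * sg m))^-1 * long_comm m i a b)%g.
Proof. by rewrite /long_part unlock. Qed.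

Lemma long_commE m i a b : long_comm m i a b = (shortL m (iopp i) (a * b * sg m) * long_part m i a b)%g.
Proof. by rewrite long_partE mulVKg. Qed.

Lemma over_long_comm m i a b : m.2 != i.2 ->
  over (long_comm m i a b) (stX m (iopp i) (a * b * sg m) * stX i (iopp i) (- (a * b ^+ 2)))%g.
Proof. by move=> mi; rewrite -{3}[i]ioppK -stX_R4 //; apply: over_lift_comm. Qed.

Lemma over_long_part m i a b : m.2 != i.2 -> over (long_part m i a b) (stX i (iopp i) (- (a * b ^+ 2))).
Proof.
move=> mi; rewrite long_partE -[stX i _ _](mulKg (stX m (iopp i) (a * b * sg m))).
by apply: overM (over_long_comm _ _ mi); apply/overV/over_shortL.
Qed.

Lemma long_partD m i a a' b : m.2 != i.2 -> long_part m i (a + a') b = (long_part m i a b * long_part m i a' b)%g.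
Proof.
move=> mi; pose A c := some_lift (stX m (iopp m) c); pose C := some_lift (stX (iopp m) (iopp i) b).
have oA c : over (A c) (stX m (iopp m) c) := over_some_lift _.
have oC : over C (stX (iopp m) (iopp i) b) := over_some_lift _.
have oAD : over (A a' * A a)%g (stX m (iopp m) (a + a')).
  by rewrite addrC -stX_R1; [exact: overM | neq].
have cE c : long_comm m i c b = lcomm (A c) C by rewrite (lcomm_over (oA c) oC).
have mi' : m.2 != (iopp i).2 by [].
have oW c := over_long_part c b mi.
have os c := over_shortL c mi'.
have AD : lconj (A a') (long_comm m i a b) = long_comm m i a b.
  rewrite long_commE lconjM (lifts_lconj (oA _) (os _)); last by apply: lifts_commute_R2; neq.
  by rewrite (lifts_lconj (oA _) (oW _)) //; apply: lifts_commute_R2; neq.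
have Ws : commute (long_part m i a b) (shortL m (iopp i) (a' * b * sg m)).
  by apply: (lifts_commuteP (oW _) (os _)); apply: lifts_commute_R2; neq.
rewrite (long_partE _ _ (a + a')).
have -> : long_comm m i (a + a') b = (long_comm m i a b * long_comm m i a' b)%g.
  by rewrite -{1}AD !cE -lcommMl (lcomm_over oAD oC).
rewrite !long_commE !mulrDl -shortLD // invgM -!mulgA.
rewrite [(long_part m i a b * (_ * _))%g]mulgA Ws -!mulgA.
by rewrite mulKg mulKg.
Qed.

Lemma long_part0 m i b : m.2 != i.2 -> long_part m i 0 b = 1%g.
Proof. by move=> mi; apply: (mulgI (long_part m i 0 b)); rewrite -long_partD // addr0 mulg1. Qed.

Lemma long_partN m i a b : m.2 != i.2 -> long_part m i (- a) b = (long_part m i a b)^-1%g.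
Proof. by move=> mi; apply/esym/mulg1_eq; rewrite -long_partD // subrr long_part0. Qed.

Definition opp_comm m i b c : E := lift_comm (stX (iopp m) (iopp i) b) (stX m (iopp i) c).

Lemma over_opp_comm m i b c : m.2 != i.2 ->
  over (opp_comm m i b c) (stX i (iopp i) (2%:R * (- (b * sg m * sg i)) * c * sg i)).
Proof.
move=> mi; rewrite -(@stX_R5 R l i m) 1?eq_sym //.
have -> : stX i m (- (b * sg m * sg i)) = stX (iopp m) (iopp i) b :> St.
  rewrite [RHS]stX_R0 ?ioppK ?sgn_opp; last by neq.
  by congr stX; ring.
exact: over_lift_comm.
Qed.

(** Expand X_{-m,-i}(b'b) = [X_{-m,-h}(b'), X_{-h,-i}(b)] inside [long_comm m i],
    as for short roots.  Now the auxiliary commutator x has two factors, a short one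
    and a long one, and the long one produces the same construction at h. *)
Lemma long_part_exchange m h i a b b' : m.2 != i.2 -> h.2 != i.2 -> m.2 != h.2 ->
  long_part m i a (b' * b) =
  ((long_part h i (a * b' ^+ 2) b)^-1 * opp_comm m i (b' * b) (a * b' * b * sg m))%g.
Proof.
move=> mi hi mh.
have im : i.2 != m.2 by rewrite eq_sym.
have ih : i.2 != h.2 by rewrite eq_sym.
have hm : h.2 != m.2 by rewrite eq_sym.
pose A := some_lift (stX m (iopp m) a).
pose B := some_lift (stX (iopp m) (iopp h) b').
pose C := some_lift (stX (iopp h) (iopp i) b).
have oA : over A (stX m (iopp m) a) := over_some_lift _.
have oB : over B (stX (iopp m) (iopp h) b') := over_some_lift _.
have oC : over C (stX (iopp h) (iopp i) b) := over_some_lift _.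
pose K := lcomm B C.
have oK : over K (stX (iopp m) (iopp i) (b' * b)).
  by rewrite -(@stX_R3 R l (iopp m) (iopp h) (iopp i)) //; apply: over_lcomm.
pose x := lcomm A B.
have ox : over x (stX m (iopp h) (a * b' * sg m) * stX h (iopp h) (- (a * b' ^+ 2)))%g.
  by rewrite -{2}[h]ioppK -stX_R4 //; apply: over_lcomm.
pose x1 := some_lift (stX m (iopp h) (a * b' * sg m)).
have ox1 : over x1 (stX m (iopp h) (a * b' * sg m)) := over_some_lift _.
pose x2 := (x1^-1 * x)%g.
have ox2 : over x2 (stX h (iopp h) (- (a * b' ^+ 2))).
  rewrite -[stX h _ _](mulKg (stX m (iopp h) (a * b' * sg m))).
  by apply: overM ox; apply: overV.
have xE : x = (x1 * x2)%g by rewrite /x2 mulVKg.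
have osi c : over (shortL m (iopp i) c) (stX m (iopp i) c) by apply: over_shortL.
have osh c : over (shortL h (iopp i) c) (stX h (iopp i) c) by apply: over_shortL.
have oWh := over_long_part (- (a * b' ^+ 2)) b hi.
(* K commutes with the long factor of x, and R3 applies to the short one *)
have xK : lcomm x K = shortL h (iopp i) (a * b' ^+ 2 * b * sg h).
  have -> : lcomm x K = lcomm x1 K.
    rewrite xE lcommMl; have -> : lcomm x2 K = 1%g.
      by apply/lcomm1P; apply: (lifts_commuteP ox2 oK); apply: lifts_commute_R2; neq.
    by rewrite lconj1 mul1g.
  have oK' : over K (stX i m (- (b' * b * sg m * sg i))).
    have -> : stX i m (- (b' * b * sg m * sg i)) = stX (iopp m) (iopp i) (b' * b) :> St.
      by rewrite [RHS]stX_R0 ?ioppK ?sgn_opp; [congr stX; ring | neq].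
    exact: oK.
  rewrite -lcommV (lcomm_over oK' ox1) lift_comm_short // -shortLN // shortL_R0 // ioppK sgn_opp.
  congr shortL; ring: (sgn_sqr R i) (sgn_sqr R m).
(* the long factor of x and C form the configuration of long_comm h i *)
have xC : lcomm x C =
    (shortL h (iopp i) (- (a * b' ^+ 2 * b * sg h)) * long_part h i (- (a * b' ^+ 2)) b
     * shortL m (iopp i) (a * b' * b * sg m))%g.
  have e1 : lcomm x1 C = shortL m (iopp i) (a * b' * b * sg m).
    by rewrite (lcomm_over ox1 oC) lift_comm_short //; congr shortL; ring.
  have e2 : lcomm x2 C = (shortL h (iopp i) (- (a * b' ^+ 2 * b * sg h)) *
      long_part h i (- (a * b' ^+ 2)) b)%g.
    rewrite (lcomm_over ox2 oC) -/(long_comm h i _ b) long_commE; congr (shortL _ _ _ * _)%g; ring.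
  rewrite xE lcommMl e1 e2 lconjM (lifts_lconj ox1 (osh _)); last by apply: lifts_commute_R2; neq.
  by rewrite (lifts_lconj ox1 oWh) //; apply: lifts_commute_R2; neq.
have KC : lconj K (lcomm x C) =
    (shortL h (iopp i) (- (a * b' ^+ 2 * b * sg h)) * long_part h i (- (a * b' ^+ 2)) b
     * (opp_comm m i (b' * b) (a * b' * b * sg m) * shortL m (iopp i) (a * b' * b * sg m)))%g.
  rewrite xC lconjM lconjM (lifts_lconj oK (osh _)); last by apply: lifts_commute_R2; neq.
  rewrite (lifts_lconj oK oWh); last by apply: lifts_commute_R2; neq.
  by rewrite (lconj_lcomm K) (lcomm_over oK (osi _)).
have DLx : long_comm m i a (b' * b) = (lcomm x K * lconj K (lcomm x C))%g.
  rewrite /long_comm -(lcomm_over oA oK) (lcomm_lconj A K) (lconjR A B C) (lifts_lconj oA oC); last by apply: lifts_commute_R2; neq.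
  rewrite (lconj_lcomm A B) -/x lcommMl -/K (lconj_lcomm x K) /lconj !mulgA //.
have Gs : commute (opp_comm m i (b' * b) (a * b' * b * sg m)) (shortL m (iopp i) (a * b' * b * sg m)).
  by apply: (lifts_commuteP (over_opp_comm _ _ mi) (osi _)); apply: lifts_commute_R2; neq.
have Wss : commute (long_part h i (- (a * b' ^+ 2)) b) (shortL m (iopp i) (a * b' * b * sg m)).
  by apply: (lifts_commuteP oWh (osi _)); apply: lifts_commute_R2; neq.
rewrite long_partE DLx xK KC -long_partN //.
have -> : a * (b' * b) * sg m = a * b' * b * sg m by ring.
rewrite shortLN // Gs -!mulgA mulVKg.
by rewrite [(long_part h i _ b * (_ * _))%g]mulgA Wss -!mulgA mulKg.
Qed.

(** In [long_part_exchange] the last factor depends only on b'b and b, b' enter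
    separately in the other one; compare b' = 1 with b = 1. *)
Lemma long_part_sqr h i a b : h.2 != i.2 -> long_part h i a b = long_part h i (a * b ^+ 2) 1.
Proof.
move=> hi; have [m [mi mh _]] := plane3 i.2 h.2 h.2 hl.
have := long_part_exchange a 1 b mi hi mh; have := long_part_exchange a b 1 mi hi mh.
rewrite mulr1 mul1r expr1n !mulr1 => -> /mulIg/invg_inj //.
Qed.

Lemma opp_comm_long_part m h i a : m.2 != i.2 -> h.2 != i.2 -> m.2 != h.2 ->
  opp_comm m i 1 (a * sg m) = (long_part h i a 1 * long_part m i a 1)%g.
Proof.
move=> mi hi mh; have := long_part_exchange a 1 1 mi hi mh.
by rewrite expr1n !mulr1 => ->; rewrite mulVKg.
Qed.

(** The values at h and h' are determined by those at any third m; this is one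
    more place where three planes besides that of i are needed. *)
Lemma long_part_indep h h' i a : h.2 != i.2 -> h'.2 != i.2 -> long_part h i a 1 = long_part h' i a 1.
Proof.
move=> hi hi'; have [m [mi mh mh']] := plane3 i.2 h.2 h'.2 hl.
by apply: (mulIg (long_part m i a 1)); rewrite -!opp_comm_long_part.
Qed.

Definition longL i a : E := long_part (mid i i) i (- a) 1.

Lemma long_part_longL h i a b : h.2 != i.2 -> long_part h i a b = longL i (- (a * b ^+ 2)).
Proof.
move=> hi; have [mi _] := midP i i.
by rewrite long_part_sqr // /longL opprK (long_part_indep _ hi mi).
Qed.

Lemma over_longL i a : over (longL i a) (stX i (iopp i) a).
Proof.
have [mi _] := midP i i; have := over_long_part (- a) 1 mi.
by rewrite mulNr expr1n mulr1 opprK.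
Qed.

Lemma longLD i a b : (longL i a * longL i b)%g = longL i (a + b).
Proof. by have [mi _] := midP i i; rewrite /longL -long_partD // opprD. Qed.

Lemma lift_R4 i j a b : i.2 != j.2 ->
  lcomm (longL i a) (shortL (iopp i) j b) = (shortL i j (a * b * sg i) * longL (iopp j) (- (a * b ^+ 2)))%g.
Proof.
move=> ij; have ij' : i.2 != (iopp j).2 by [].
rewrite (lcomm_over (over_longL i a) (over_shortL b _)) // -{1}[j]ioppK -/(long_comm i (iopp j) a b).
by rewrite long_commE long_part_longL // ioppK.
Qed.

(** The analogue of [lift_comm_exchange] when j = -i. *)
Lemma lift_comm_long_exchange i m h b c : m.2 != i.2 -> h.2 != i.2 -> m.2 != h.2 ->
  lift_comm (stX i m b) (stX m (iopp i) c) = lift_comm (stX i h (b * c)) (stX h (iopp i) 1).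
Proof.
move=> mi hi mh.
have im : i.2 != m.2 by rewrite eq_sym.
have ih : i.2 != h.2 by rewrite eq_sym.
pose A := some_lift (stX i m b); pose B := some_lift (stX m h c); pose C := some_lift (stX h (iopp i) 1).
have oA : over A (stX i m b) := over_some_lift _.
have oB : over B (stX m h c) := over_some_lift _.
have oC : over C (stX h (iopp i) 1) := over_some_lift _.
have oK : over (lcomm B C) (stX m (iopp i) c).
  by rewrite -[c]mulr1 -(@stX_R3 R l m h (iopp i)) //; apply: over_lcomm.
have ox : over (lcomm A B) (stX i h (b * c)).
  by rewrite -(@stX_R3 R l i m h) //; apply: over_lcomm.
have oxC : over (lcomm (lcomm A B) C) (stX i (iopp i) (2%:R * (b * c) * 1 * sg i)).
  by rewrite -(@stX_R5 R l i h) //; apply: over_lcomm.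
rewrite -(lcomm_over oA oK) lcomm_lconj lconjR (lifts_lconj oA oC); last by apply: lifts_commute_R2; neq.
rewrite (lconj_lcomm A B) lcommMl (lifts_lconj ox oK); last by apply: lifts_commute_R2; neq.
have -> : (lcomm B C * lcomm (lcomm A B) C = lcomm (lcomm A B) C * lcomm B C)%g.
  by apply: (lifts_commuteP oK oxC); apply: lifts_commute_R2; neq.
by rewrite mulgK; apply: lcomm_over.
Qed.

(** Moving the commutator from j to another plane and back shows that it only
    depends on ab, and [opp_comm_long_part] evaluates it. *)
Lemma lift_R5 i j a b : i.2 != j.2 ->
  lcomm (shortL i j a) (shortL j (iopp i) b) = longL i (2%:R * a * b * sg i).
Proof.
move=> ij; have ji : j.2 != i.2 by rewrite eq_sym.
have [h [hi hj _]] := plane3 i.2 j.2 j.2 hl.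
have jh : j.2 != h.2 by rewrite eq_sym.
rewrite (lcomm_over (over_shortL a ij) (over_shortL b _)) // (lift_comm_long_exchange _ _ ji hi jh).
pose c := - (a * b * sg i).
have := opp_comm_long_part c ji hi jh; rewrite !long_part_longL // longLD.
have -> : opp_comm j i 1 (c * sg j) = lift_comm (stX i j (- (sg i * sg j))) (stX j (iopp i) (c * sg j)).
  congr (lift_comm _ _); rewrite stX_R0 ?ioppK ?sgn_opp; last by neq.
  by congr stX; ring.
rewrite (lift_comm_long_exchange _ _ ji hi jh) => H.
have -> : a * b = - (sg i * sg j) * (c * sg j).
  by rewrite /c; ring: (sgn_sqr R i) (sgn_sqr R j).
by rewrite H /c; congr longL; ring.
Qed.

Definition liftX (x : stgen R l) : E :=
  if st_j x == iopp (st_i x) then longL (st_i x) (st_a x) else shortL (st_i x) (st_j x) (st_a x).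

Lemma liftXE i j (ij : i != j) a :
  liftX (STGen ij a) = if j == iopp i then longL i a else shortL i j a.
Proof. by []. Qed.

Lemma liftX_long i (ii : i != iopp i) a : liftX (STGen ii a) = longL i a.
Proof. by rewrite liftXE eqxx. Qed.

Lemma liftX_short i j (ij : i != j) a : i.2 != j.2 -> liftX (STGen ij a) = shortL i j a.
Proof.
by move=> ij2; rewrite liftXE ifN //; apply: plane_neq; rewrite eq_sym.
Qed.

Lemma over_liftX i j (ij : i != j) a : over (liftX (STGen ij a)) (stX i j a).
Proof.
have [e|n] := eqVneq i.2 j.2; last by rewrite liftX_short //; apply: over_shortL.
have ji := same_plane e ij; subst j.
by rewrite liftX_long; apply: over_longL.
Qed.

Lemma neq2_plane i j : i != j -> i != iopp j -> i.2 != j.2.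
Proof. by move=> ij; apply: contraNneq => e; rewrite (same_plane e ij) ioppK. Qed.

Lemma liftX_rel t t' : st_rel t t' -> geval liftX t = geval liftX t'.
Proof.
case=> {t t'}.
- move=> i j ij ji a /=; have [e|n] := eqVneq i.2 j.2.
    have jE := same_plane e ij; subst j.
    rewrite liftX_long liftXE ioppK eqxx sgn_opp.
    by rewrite ioppK mulrN opprK -mulrA sgn_sqr mulr1.
  have n' : (iopp j).2 != (iopp i).2 by rewrite eq_sym.
  by rewrite !liftX_short // shortL_R0.
- move=> i j ij a b /=; have [e|n] := eqVneq i.2 j.2.
    by have jE := same_plane e ij; subst j; rewrite !liftX_long longLD.
  by rewrite !liftX_short // shortLD.
- move=> i j h k ij hk a b hj hi ki kj /=; rewrite -lcommE; apply/lcomm1P.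
  by apply: (lifts_commuteP (over_liftX _ _) (over_liftX _ _)); apply: lifts_commute_R2.
- move=> i j k ij jk ik a b nij nik njk /=.
  have [ij2 ik2 jk2] : [/\ i.2 != j.2, i.2 != k.2 & j.2 != k.2].
    by split; apply: neq2_plane.
  have ji2 : j.2 != i.2 by rewrite eq_sym.
  rewrite !liftX_short // -lcommE (lcomm_over (over_shortL _ _) (over_shortL _ _)) //.
  exact: lift_comm_short.
- move=> i j ii ij' ij jj a b /=.
  have ij2 : i.2 != j.2 by apply: neq2_plane => //; rewrite -iopp_eqr.
  rewrite liftX_long (liftX_short ij') // (liftX_short ij) // -lcommE lift_R4 //; congr (_ * _)%g.
  by rewrite liftXE ioppK eqxx.
- move=> i j ij ji ii a b /=.
  have ij2 : i.2 != j.2 by apply: neq2_plane => //; rewrite eq_sym iopp_eqr in ji.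
  have ji2 : j.2 != (iopp i).2 by rewrite eq_sym.
  by rewrite liftX_long !liftX_short // -lcommE lift_R5.
Qed.

Theorem St_lift : exists2 psi : St -> E,
  {morph psi : x y / (x * y)%g} & forall x, proj (psi x) = phi x.
Proof.
exists (pres_lift liftX) => [|x]; first exact: pres_liftM liftX_rel.
have psiM : {morph (pres_lift liftX : St -> E) : x y / (x * y)%g} := pres_liftM liftX_rel.
elim/St_ind: x => [x y xE yE|x xE|i j a ij|].
- by rewrite psiM projM xE yE phiM.
- rewrite phiV -xE -projV; congr proj; apply/esym/mulg1_eq.
  rewrite -psiM mulgV.
  by apply: (mulgI (pres_lift liftX (1%g : St))); rewrite -psiM !mulg1.
- have <- : liftX (STGen ij a) = pres_lift liftX (stX i j a : St).
    by rewrite (stXE ij); apply/esym/(pres_lift_gen liftX_rel).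
  exact: over_liftX.
- have e : pres_lift liftX (1%g : St) = 1%g.
    by apply: (mulgI (pres_lift liftX (1%g : St))); rewrite -psiM !mulg1.
  by rewrite e proj1 gmulf1.
Qed.

End Lifting.

Lemma St_perfect (R : comPzRingType) (l : nat) (hl : (4 <= l)%N) (P : StSp R l -> Prop) :
  P 1%g -> (forall x y, P x -> P y -> P (x * y)%g) -> (forall x, P x -> P x^-1%g) ->
  (forall x y, P (lcomm x y)) -> forall x, P x.
Proof.
move=> P1 PM PV PC; apply: St_ind => // i j a ij.
have [m [mi mj _]] := plane3 i.2 j.2 j.2 hl.
have short h k b : h.2 != k.2 -> P (stX h k b).
  move=> hk; have [n [nh nk _]] := plane3 h.2 k.2 k.2 hl.
  by rewrite -[b]mulr1 -(@stX_R3 R l h n k) // eq_sym.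
have [e|] := eqVneq i.2 j.2; last exact: short.
rewrite (same_plane e ij).
have -> : stX i (iopp i) a = ((stX m (iopp i) (- a * 1 * sgn R m))^-1 *
    lcomm (stX m (iopp m) (- a)) (stX (iopp m) (iopp i) 1))%g.
  by rewrite stX_R4 // mulKg ioppK expr1n mulr1 opprK.
by apply: PM; [apply/PV/short | apply: PC].
Qed.

(** * The unipotent radicals *)

Section Heisenberg.
Variables (R : comPzRingType) (l : nat).
Local Notation St := (StSp R l).
Local Notation idx := (idx l).
Local Notation vec := (vec R l).
Local Notation sg := (@sgn R l).
Local Notation e := (@bvec R l).
Implicit Types (i j h k m : idx) (a b c : R) (v w : vec) (g : St) (p : 'I_l).

(** [shortX i k b] lifts T(e_i, b e_k, 0) and [longX i a] lifts T(e_i, 0, a); in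
    this normalisation R0 becomes a symmetry in i and k. *)
Definition shortX i k b : St := stX i (iopp k) (b * sg k).
Definition longX i a : St := stX i (iopp i) a.

Lemma shortXD i k b c : i.2 != k.2 -> (shortX i k b * shortX i k c)%g = shortX i k (b + c).
Proof. by move=> ik; rewrite /shortX stX_R1 ?mulrDl //; apply: plane_neq. Qed.
Lemma longXD i a b : (longX i a * longX i b)%g = longX i (a + b).
Proof. by rewrite /longX stX_R1 ?iopp_neq. Qed.
Lemma shortX0 i k : shortX i k 0 = 1%g. Proof. by rewrite /shortX mul0r stX0. Qed.
Lemma longX0 i : longX i 0 = 1%g. Proof. exact: stX0. Qed.

Lemma shortX_sym i k b : i.2 != k.2 -> shortX i k b = shortX k i b.
Proof.
move=> ik; rewrite /shortX stX_R0 ?ioppK ?sgn_opp; last exact: plane_neq.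
by congr stX; ring: (sgn_sqr R k).
Qed.

Lemma shortX_commute i k k' b c : i.2 != k.2 -> i.2 != k'.2 -> k' != iopp k ->
  commute (shortX i k b) (shortX i k' c).
Proof.
move=> ik ik' kk; apply/lcomm1P; apply: stX_R2; rewrite ?iopp_neq ?iopp_eq //.
all: by apply: plane_neq; rewrite // eq_sym.
Qed.

Lemma longX_shortX i k a b : i.2 != k.2 -> commute (longX i a) (shortX i k b).
Proof.
move=> ik; have ki : k.2 != i.2 by rewrite eq_sym.
by apply/lcomm1P; apply: stX_R2; rewrite ?iopp_neq //; apply: plane_neq.
Qed.

Lemma lcomm_shortX_opp i k b c : i.2 != k.2 ->
  lcomm (shortX i k b) (shortX i (iopp k) c) = longX i (2%:R * b * c * sg k).
Proof.
move=> ik; rewrite (shortX_sym c) // stX_R5 //; congr stX.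
by ring: (sgn_sqr R i).
Qed.

(** The lift of T(e_i, p e_k + q e_{-k}, 0) for k = (false, j).  The last factor
    compensates <p e_k, q e_{-k}> = pq. *)
Definition planeX i (j : 'I_l) (pq : R * R) : St :=
  (shortX i (false, j) pq.1 * shortX i (true, j) pq.2 * longX i (- (pq.1 * pq.2)))%g.

Lemma longX_planeX i (j : 'I_l) pq a : j != i.2 -> commute (longX i a) (planeX i j pq).
Proof.
rewrite eq_sym => ij; apply: commuteM; first apply: commuteM.
- exact: longX_shortX.
- exact: longX_shortX.
by rewrite /commute !longXD addrC.
Qed.

Lemma planeX_commute i (j j' : 'I_l) pq pq' : j != i.2 -> j' != i.2 -> j != j' ->
  commute (planeX i j pq) (planeX i j' pq').
Proof.
move=> ji j'i jj; have ij : i.2 != j by rewrite eq_sym.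
have ij' : i.2 != j' by rewrite eq_sym.
have L := longX_planeX _ _ j'i.
apply/commute_sym; apply: commuteM; last exact/commute_sym/longX_planeX.
apply: commuteM; apply/commute_sym; apply: commuteM.
all: try by apply/commute_sym/longX_shortX.
all: apply: commuteM; apply: shortX_commute => //=; apply: plane_neq => //=; by rewrite eq_sym.
Qed.

Lemma planeXM i (j : 'I_l) pq pq' : j != i.2 -> (planeX i j pq * planeX i j pq')%g =
  (longX i (pq.1 * pq'.2 - pq.2 * pq'.1) * planeX i j (pq + pq'))%g.
Proof.
case: pq pq' => [p q] [p' q']; rewrite eq_sym => ij; rewrite /planeX /=.
have kf : i.2 != (false, j).2 by [].
have kt : i.2 != (true, j).2 by [].
have L k : i.2 != k.2 -> forall a b, (longX i a * shortX i k b = shortX i k b * longX i a)%g.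
  by move=> *; apply: longX_shortX.
have L' k : i.2 != k.2 -> forall a b x,
    (longX i a * (shortX i k b * x) = shortX i k b * (longX i a * x))%g.
  by move=> ik a b x; rewrite mulgA L // mulgA.
have lgD' a b x : (longX i a * (longX i b * x) = longX i (a + b) * x)%g by rewrite mulgA longXD.
have sw : (shortX i (true, j) q * shortX i (false, j) p' =
  shortX i (false, j) p' * shortX i (true, j) q * longX i (- (2%:R * q * p')))%g.
  rewrite mul_lconj lconj_lcomm [shortX i (false, j) p' in LHS]/(shortX i (iopp (true, j)) p').
  rewrite lcomm_shortX_opp // -!mulgA L' // L //; congr (_ * (_ * longX i _))%g.
  by rewrite /sgn /=; ring.
have sw' x : (shortX i (true, j) q * (shortX i (false, j) p' * x) =
  shortX i (false, j) p' * (shortX i (true, j) q * (longX i (- (2%:R * q * p')) * x)))%g.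
  by rewrite mulgA sw !mulgA.
rewrite -!shortXD // -!mulgA !(L' _ kf, L' _ kt, L _ kf, L _ kt, longXD, lgD', sw').
by congr (_ * (_ * (_ * (_ * longX i _))))%g; ring.
Qed.

Definition plane_coord v (j : 'I_l) : R * R := (v (false, j), v (true, j)).

(** The element x_i(v, a) lifting T(e_i, v, a).  The coordinates of v in the plane
    of i are ignored.  Locked, since associativity would rewrite inside. *)
Fact radX_key : unit. Proof. exact: tt. Qed.
Definition radX i v a : St := locked_with radX_key
  (longX i a * \prod_(j : 'I_l | j != i.2) planeX i j (plane_coord v j))%g.

Lemma radXE i v a :
  radX i v a = (longX i a * \prod_(j : 'I_l | j != i.2) planeX i j (plane_coord v j))%g.
Proof. by rewrite /radX unlock. Qed.

Definition off_plane p v := (v (false, p) = 0) /\ (v (true, p) = 0).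

Lemma sform_planes v w :
  sform v w = \sum_(j : 'I_l) (v (false, j) * w (true, j) - v (true, j) * w (false, j)).
Proof.
pose F (s : bool) (j : 'I_l) := sg (s, j) * v (s, j) * w (iopp (s, j)).
transitivity (\sum_(sj : bool * 'I_l) F sj.1 sj.2); first by apply: eq_bigr => [[]].
rewrite -(pair_bigA _ F) {}/F.
rewrite big_bool /= addrC -big_split /=; apply: eq_bigr => j _.
by rewrite /sgn /=; ring.
Qed.

(** The group law is that of the Heisenberg group: factors from distinct planes
    commute, and within a plane [planeXM] produces the form. *)
Lemma radXM i v w a b : off_plane i.2 v ->
  (radX i v a * radX i w b)%g = radX i (v + w) (a + b + sform v w).
Proof.
move=> [v0 v1]; rewrite sform_planes (bigD1 i.2) //= v0 v1 !mul0r subr0 add0r.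
rewrite !radXE; have := index_enum_uniq 'I_l.
elim: (index_enum _) a b => [|j s IH] a b /=.
  by rewrite !big_nil !mulg1 longXD addr0.
case/andP => js us; rewrite !big_cons; case: ifP => ji; last exact: IH.
have C u c : (longX i c * planeX i j (plane_coord u j) = planeX i j (plane_coord u j) * longX i c)%g.
  by apply: longX_planeX.
have CC : commute (\prod_(j0 <- s | j0 != i.2) planeX i j0 (plane_coord v j0))%g (planeX i j (plane_coord w j)).
  apply/commute_sym.
  elim: (s) js => [|j' s' IH']; first by rewrite big_nil => _; apply: commute1.
  rewrite inE negb_or big_cons => /andP[jj' js']; case: ifP => j'i; last exact: IH'.
  by apply: commuteM; [apply: planeX_commute | exact: IH'].
set H1 := planeX i j (plane_coord v j); set H2 := planeX i j (plane_coord w j).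
set Pv := (\prod_(_ <- _ | _) _)%g; set Pw := (\prod_(_ <- _ | _) planeX _ _ (plane_coord w _))%g.
have C1 c : (longX i c * H1 = H1 * longX i c)%g by apply: C.
have C2 c : (longX i c * H2 = H2 * longX i c)%g by apply: C.
have {}CC : (Pv * H2 = H2 * Pv)%g by apply: CC.
have four (x y H P Q : St) : (x * H1 = H1 * x -> x * H = H * x -> y * H = H * y ->
    P * H = H * P -> x * (H1 * P) * (y * (H * Q)) = H1 * H * ((x * P) * (y * Q)))%g.
  move=> e1 e2 e3 e4; clearbody H1; rewrite !mulgA e1 -[(_ * y * H)%g]mulgA e3 mulgA.
  by rewrite -[(_ * P * H)%g]mulgA e4 mulgA -[(_ * x * H)%g]mulgA e2 mulgA.
rewrite four // {four}.
rewrite IH // planeXM // mulgA -[(longX i _ * _ * longX i _)%g]mulgA.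
have -> : plane_coord v j + plane_coord w j = plane_coord (v + w) j by rewrite /plane_coord !ffunE.
rewrite -C mulgA longXD -mulgA; congr (_ * _)%g.
by congr longX; rewrite /plane_coord /=; ring.
Qed.

End Heisenberg.

(** * Elements acting on a radical through the symplectic group *)

Section Levi.
Variables (R : comPzRingType) (l : nat).
Local Notation St := (StSp R l).
Local Notation idx := (idx l).
Local Notation vec := (vec R l).
Local Notation sg := (@sgn R l).
Local Notation e := (@bvec R l).
Implicit Types (i j h k m : idx) (a b c : R) (v w : vec) (g : St) (p : 'I_l).

Lemma radX0 i a : radX i (0 : vec) a = longX i a.
Proof.
rewrite radXE big1 ?mulg1 // => j _.
by rewrite /planeX /plane_coord !ffunE !shortX0 mul0r oppr0 longX0 !mulg1.
Qed.

Lemma radX_bvec i k b : i.2 != k.2 -> radX i (b *: e k) 0 = shortX i k b.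
Proof.
move=> ik; rewrite radXE longX0 mul1g (big_only1 k.2) ?[k.2 == _]eq_sym // => [|j jk _].
  case: k ik => [[] p] /= ip; rewrite /planeX /plane_coord !ffunE !xpair_eqE /= !eqxx /=.
    by rewrite /GRing.scale /= !mulr0 !mulr1 shortX0 mul0r oppr0 longX0 mul1g mulg1.
  by rewrite /GRing.scale /= !mulr0 !mulr1 shortX0 oppr0 longX0 !mulg1.
rewrite /planeX /plane_coord !ffunE; case: k ik jk => [s p] /= ip jp.
rewrite !xpair_eqE (negPf jp) !andbF /GRing.scale /= !mulr0.
by rewrite !shortX0 oppr0 longX0 !mulg1.
Qed.

Lemma off_plane0 p : off_plane p (0 : vec). Proof. by split; rewrite ffunE. Qed.
Lemma off_planeD p v w : off_plane p v -> off_plane p w -> off_plane p (v + w).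
Proof. by move=> [v0 v1] [w0 w1]; split; rewrite ffunE ?v0 ?v1 ?w0 ?w1 addr0. Qed.
Lemma off_planeZ p a v : off_plane p v -> off_plane p (a *: v).
Proof. by move=> [v0 v1]; split; rewrite ffunE /GRing.scale /= ?v0 ?v1 mulr0. Qed.
Lemma off_planeN p v : off_plane p v -> off_plane p (- v).
Proof. by rewrite -scaleN1r; apply: off_planeZ. Qed.
Lemma off_plane_bvec p k : k.2 != p -> off_plane p (e k).
Proof.
case: k => s q /= qp.
by split; rewrite ffunE xpair_eqE [p == q]eq_sym (negPf qp) andbF.
Qed.

Lemma off_plane_ind p (P : vec -> Prop) : P 0 ->
  (forall v w, off_plane p v -> off_plane p w -> P v -> P w -> P (v + w)) ->
  (forall k b, k.2 != p -> P (b *: e k)) -> forall v, off_plane p v -> P v.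
Proof.
move=> P0 PD Pe v vp.
have -> : v = \sum_k v k *: e k.
  apply/ffunP => k; rewrite sum_ffunE (bigD1 k) //= !ffunE eqxx big1 => [|j jk].
    by rewrite /GRing.scale /= mulr1 addr0.
  by rewrite !ffunE /GRing.scale /= eq_sym (negPf jk) mulr0.
suff : P (\sum_k v k *: e k) /\ off_plane p (\sum_k v k *: e k) by case.
elim/big_rec: _ => [|k w _ [Pw pw]]; first by split => //; apply: off_plane0.
have [kp|kp] := eqVneq k.2 p.
  suff -> : v k = 0 by rewrite scale0r add0r.
  by case: vp => v0 v1; case: k kp => [[] q] /= ->.
have pk : off_plane p (v k *: e k) by exact/off_planeZ/off_plane_bvec.
by split; [apply: PD => //; apply: Pe | apply: off_planeD].
Qed.

Lemma form_bvec_off k v : off_plane k.2 v -> sform (e k) v = 0.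
Proof. by move=> [v0 v1]; rewrite sform_bvecl; case: k v0 v1 => [[] q] /= v0 v1; rewrite /iopp /= ?v0 ?v1 mulr0. Qed.
Lemma form_off_bvec k v : off_plane k.2 v -> sform v (e k) = 0.
Proof. by move=> vk; rewrite sformC form_bvec_off // oppr0. Qed.

Lemma form_bvec_planes i k : i.2 != k.2 -> sform (e i) (e k) = 0.
Proof. by move=> ik; apply: form_bvec_off; apply: off_plane_bvec; rewrite eq_sym. Qed.
Lemma form_bvec_opp i : sform (e i) (e (iopp i)) = sg i.
Proof. by rewrite sform_bvec ioppK eqxx mulr1. Qed.
Lemma form_opp_bvec i : sform (e (iopp i)) (e i) = - sg i.
Proof. by rewrite -[e i in LHS]/(e i) sformC form_bvec_opp. Qed.
Lemma form0l v : sform (0 : vec) v = 0.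
Proof. by rewrite -(scale0r (0 : vec)) sformZl mul0r. Qed.
Lemma form0r v : sform v (0 : vec) = 0.
Proof. by rewrite sformC form0l oppr0. Qed.
Lemma formNl v w : sform (- v) w = - sform v w.
Proof. by rewrite -scaleN1r sformZl mulN1r. Qed.
Lemma formNr v w : sform v (- w) = - sform v w.
Proof. by rewrite -scaleN1r sformZr mulN1r. Qed.

Definition act g v : vec := sp_fun (ep_val (phi g)) v.

Lemma actM g g' v : act (g * g')%g v = act g (act g' v).
Proof. by rewrite /act gmulfM. Qed.
Lemma act1 v : act 1%g v = v.
Proof. by rewrite /act gmulf1. Qed.
Lemma act_symp g : is_symplectic (act g).
Proof. exact/asboolP/sp_funP. Qed.
Lemma actD g v w : act g (v + w) = act g v + act g w.
Proof. by have [/(_ 1 v w)] := act_symp g; rewrite !scale1r. Qed.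
Lemma act0 g : act g 0 = 0.
Proof. by apply: (addrI (act g 0)); rewrite -actD !addr0. Qed.
Lemma actZ g a v : act g (a *: v) = a *: act g v.
Proof. by have [/(_ a v 0)] := act_symp g; rewrite !addr0 act0 addr0. Qed.
Lemma act_form g v w : sform (act g v) (act g w) = sform v w.
Proof. by have [_ _] := act_symp g. Qed.
Lemma act_shortX i k b v : i.2 != k.2 ->
  act (shortX i k b) v = transv (e i) (b *: e k) 0 v.
Proof.
move=> /plane_neq3[ik ik' ki kk]; rewrite /act /shortX (stXE ik') phi_X /= /Tfun.
by rewrite iopp_eq eq_sym (negPf ik) ioppK -mulrA sgn_sqr mulr1.
Qed.
Lemma act_longX i a v : act (longX i a) v = transv (e i) 0 a v.
Proof. by rewrite /act /longX (stXE (iopp_neq i)) phi_X /= /Tfun eqxx. Qed.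

(** The elements of StSp that fix the plane p and act on both Heisenberg groups
    x_s, s in the plane p, as their images in Sp do.  They include the images
    of the generators of the Steinberg group of the other planes, and the lifts
    of transvections constructed below. *)
Definition levi p g := forall s : idx, s.2 = p ->
  act g (e s) = e s /\
  forall v a, off_plane p v -> lconj g (radX s v a) = radX s (act g v) a.

Lemma fix_off_plane p g v : (forall s : idx, s.2 = p -> act g (e s) = e s) ->
  off_plane p v -> off_plane p (act g v).
Proof.
move=> ge vp.
have H s : s.2 = p -> act g v (iopp s) = 0.
  move=> sp; have : sform (e s) (act g v) = 0.
    by rewrite -(ge s sp) act_form form_bvec_off // sp.
  rewrite sform_bvecl => /(congr1 (fun x => sg s * x)).
  by rewrite mulrA sgn_sqr mul1r mulr0.
split; first exact: (H (true, p)).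
exact: (H (false, p)).
Qed.

Lemma levi_off_plane p g v : levi p g -> off_plane p v -> off_plane p (act g v).
Proof. by move=> gp; apply: fix_off_plane => s /gp[]. Qed.

Lemma levi1 p : levi p 1%g.
Proof. by move=> s _; split=> [|v a _]; rewrite act1 // /lconj mul1g invg1 mulg1. Qed.

Lemma leviM p g g' : levi p g -> levi p g' -> levi p (g * g')%g.
Proof.
move=> gp hp s sp; have [ge gx] := gp s sp; have [he hx] := hp s sp.
by split=> [|v a vp]; rewrite actM ?he // lconjMl hx // gx //; apply: levi_off_plane.
Qed.

Lemma lconj_radX p g s v a : levi p g -> s.2 = p -> off_plane p v ->
  lconj g (radX s v a) = radX s (act g v) a.
Proof. by move=> gp sp; have [_] := gp s sp; apply. Qed.

(** As v |-> x_s(v, a) is a Heisenberg group morphism and the image of g is linear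
    and preserves the form, it suffices to test v = b e_k. *)
Lemma levi_generators p g : (forall s : idx, s.2 = p -> act g (e s) = e s) ->
  (forall (s : idx) a, s.2 = p -> lconj g (longX s a) = longX s a) ->
  (forall (s k : idx) b, s.2 = p -> k.2 != p ->
     lconj g (shortX s k b) = radX s (act g (b *: e k)) 0) ->
  levi p g.
Proof.
move=> ge gl gk s sp; split=> [|v a vp]; first exact: ge.
move: v vp a; apply: off_plane_ind => [a|v w vw ww IHv IHw a|k b kp a].
- by rewrite act0 !radX0 gl.
- have E v' w' : off_plane p v' -> sform v' w' = sform v w ->
      radX s (v' + w') a = (radX s v' (a - sform v w) * radX s w' 0)%g.
    by move=> v'p <-; rewrite radXM ?sp // addr0 subrK.
  rewrite E // lconjM IHv IHw actD -E ?act_form //; exact: fix_off_plane.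
have E v' : off_plane p v' -> radX s v' a = (radX s v' 0 * longX s a)%g.
  by move=> v'p; rewrite -radX0 radXM ?sp // form0r !addr0 add0r.
have kV : off_plane p (b *: e k) by exact/off_planeZ/off_plane_bvec.
by rewrite E // radX_bvec ?sp 1?eq_sym // lconjM (gl s a sp) (gk s k b sp kp) -E //; apply: fix_off_plane.
Qed.

Lemma longX_longX_commute (h s : idx) a b : h.2 != s.2 -> commute (longX h a) (longX s b).
Proof.
move=> /plane_neq3[]; rewrite ![h == _]eq_sym ![iopp h == _]eq_sym => *.
by apply/lcomm1P/stX_R2; rewrite ?iopp_neq ?iopp_eq // iopp_eqr.
Qed.

Lemma longX_shortX_commute (h s k : idx) a b : h.2 != s.2 -> s.2 != k.2 -> k != iopp h ->
  commute (longX h a) (shortX s k b).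
Proof.
move=> /plane_neq3[]; rewrite ![h == _]eq_sym ![iopp h == _]eq_sym => ? ? ? ?.
move=> /plane_neq3[? ? ? ?] ?.
by apply/lcomm1P/stX_R2; rewrite ?iopp_neq ?iopp_eq // iopp_eqr.
Qed.

Lemma shortX_shortX_commute (h m s k : idx) a b : h.2 != m.2 -> h.2 != s.2 -> m.2 != s.2 ->
  s.2 != k.2 -> k != iopp h -> k != iopp m -> commute (shortX h m a) (shortX s k b).
Proof.
move=> /plane_neq3[? ? ? ?] /plane_neq3[]. 
rewrite ![h == _]eq_sym ![iopp h == _]eq_sym => ? ? ? ?.
move=> /plane_neq3[]; rewrite ![m == _]eq_sym ![iopp m == _]eq_sym => ? ? ? ?.
move=> /plane_neq3[? ? ? ?] ? ?.
by apply/lcomm1P/stX_R2; rewrite ?iopp_eq ?iopp_eqr // ?iopp_eqr.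
Qed.

Lemma lconj_longX_shortX (h s : idx) a b : h.2 != s.2 -> 
  lconj (longX h a) (shortX s (iopp h) b) = radX s (b *: e (iopp h) + (a * b * sg h) *: e h) 0.
Proof.
move=> hs; have sh : s.2 != h.2 by rewrite eq_sym.
rewrite lconj_lcomm -[shortX s _ b]/(shortX s (iopp h) b) (shortX_sym _ (k := iopp h)) // {1}/shortX /longX stX_R4 //.
have -> : stX h (iopp s) (a * (b * sg s) * sg h) = radX s ((a * b * sg h) *: e h) 0.
  rewrite radX_bvec // shortX_sym // /shortX; congr stX; ring.
have -> : stX (iopp (iopp s)) (iopp s) (- (a * (b * sg s) ^+ 2)) =
    radX s 0 (- (a * b ^+ 2)).
  by rewrite radX0 ioppK /longX; congr stX; ring: (sgn_sqr R s).
rewrite shortX_sym // -radX_bvec //.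
have hV c k : k.2 = h.2 -> off_plane s.2 (c *: e k) by move=> kh; apply/off_planeZ/off_plane_bvec; rewrite kh.
rewrite !radXM ?addr0 //; try by apply: hV.
rewrite addrC; congr radX; rewrite form0r sformZl sformZr form_bvec_opp.
by ring: (sgn_sqr R h).
Qed.

Lemma lconj_shortX_shortX (h m s : idx) a b : h.2 != m.2 -> h.2 != s.2 -> m.2 != s.2 ->
  lconj (shortX h m a) (shortX s (iopp m) b) = radX s (b *: e (iopp m) + (a * b * sg m) *: e h) 0.
Proof.
move=> hm hs ms; have sh : s.2 != h.2 by rewrite eq_sym.
have sm : s.2 != m.2 by rewrite eq_sym.
rewrite lconj_lcomm {1}(shortX_sym _ (k := iopp m)) // {1 2}/shortX stX_R3 //.
have -> : stX h (iopp s) (a * sg m * (b * sg s)) = radX s ((a * b * sg m) *: e h) 0.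
  rewrite radX_bvec // shortX_sym // /shortX; congr stX; ring.
have hV c k : k.2 != s.2 -> off_plane s.2 (c *: e k) by move=> kh; apply/off_planeZ/off_plane_bvec.
rewrite -radX_bvec // radXM ?addr0 //; last exact: hV.
by rewrite addrC sformZl sformZr form_bvec_planes // !mulr0 addr0.
Qed.

Lemma levi_longX p (h : idx) c : h.2 != p -> levi p (longX h c).
Proof.
move=> hp; apply: levi_generators => [s sp|s a sp|s k b sp kp].
- by rewrite act_longX /transv form0l form_bvec_planes ?sp // mulr0 addr0 scale0r scaler0 !addr0.
- by apply/lconj_fix/longX_longX_commute; rewrite sp.
rewrite act_longX /transv form0l add0r sformZr scaler0 addr0 sform_bvec.
have [kh|kh] := eqVneq h (iopp k); last first.
  rewrite !mulr0 scale0r addr0 radX_bvec ?sp 1?eq_sym //; apply/lconj_fix/longX_shortX_commute; rewrite ?sp // 1?eq_sym //.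
  by rewrite iopp_eqr.
have {kh}-> : k = iopp h by rewrite kh ioppK.
by rewrite mulr1 lconj_longX_shortX ?sp // mulrA.
Qed.

Lemma levi_shortX p (h m : idx) c : h.2 != m.2 -> h.2 != p -> m.2 != p -> levi p (shortX h m c).
Proof.
move=> hm hp mp; apply: levi_generators => [s sp|s a sp|s k b sp kp].
- by rewrite act_shortX // /transv sformZl !form_bvec_planes ?sp // !mulr0 addr0 !scale0r !addr0.
- apply/lconj_fix/commute_sym/longX_shortX_commute => //; first by rewrite sp eq_sym.
  by apply: plane_neq; rewrite /= sp.
have sk : s.2 != k.2 by rewrite sp eq_sym.
rewrite act_shortX // /transv mul0r addr0 !sformZl !sformZr !sform_bvec.
have [kh|kh] := eqVneq m (iopp k).
  have {kh}-> : k = iopp m by rewrite kh ioppK.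
  rewrite ioppK (negPf (plane_neq hm)) mulr1 !mulr0 scale0r addr0 lconj_shortX_shortX ?sp //.
  by congr radX; congr (_ + _ *: _); ring.
have [kh'|kh'] := eqVneq h (iopp k).
  have {kh'}-> : k = iopp h by rewrite kh' ioppK.
  have mh : m.2 != h.2 by rewrite eq_sym.
  rewrite !mulr0 scale0r addr0 mulr1 shortX_sym // lconj_shortX_shortX ?sp //.
  by congr radX; apply/ffunP => z; rewrite !ffunE /GRing.scale /=; ring.
rewrite !mulr0 !scale0r !addr0 radX_bvec //; subst p; apply/lconj_fix/shortX_shortX_commute => //.
  by rewrite eq_sym iopp_eqr.
by rewrite eq_sym iopp_eqr.
Qed.

End Levi.

(** * Lifts of T(v, 0, a) for v off a plane *)

Section Siegel.
Variables (R : comPzRingType) (l : nat).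
Local Notation St := (StSp R l).
Local Notation idx := (idx l).
Local Notation vec := (vec R l).
Local Notation sg := (@sgn R l).
Local Notation e := (@bvec R l).
Implicit Types (i j h k m : idx) (a b c : R) (v w : vec) (g x y : St) (p : 'I_l).

Lemma form_off4 i v : off_plane i.2 v ->
  [/\ sform (e i) v = 0, sform v (e i) = 0,
      sform (e (iopp i)) v = 0 & sform v (e (iopp i)) = 0].
Proof. by move=> vi; rewrite !form_bvec_off ?form_off_bvec. Qed.

Lemma form_planes4 i j : i.2 != j.2 ->
  [/\ sform (e i) (e j) = 0, sform (e i) (e (iopp j)) = 0,
      sform (e (iopp i)) (e j) = 0 & sform (e (iopp i)) (e (iopp j)) = 0].
Proof. by move=> ij; rewrite !form_bvec_planes. Qed.

Definition form_lin := (@sformDl R l, @sformDr R l, @sformZl R l, @sformZr R l,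
  @formNl R l, @formNr R l, @sformvv R l, @form_bvec_opp R l, @form_opp_bvec R l,
  @form0l R l, @form0r R l).

Ltac vring := apply/ffunP => ?; rewrite !ffunE /GRing.scale /=; ring.

Lemma transvM u v w a b (x : vec) : sform u v = 0 -> sform u w = 0 ->
  transv u v a (transv u w b x) = transv u (v + w) (a + b + sform v w) x.
Proof.
move=> uv uw; have vu : sform v u = 0 by rewrite sformC uv oppr0.
by rewrite /transv !form_lin ?uv ?uw ?vu; vring.
Qed.

Lemma levi_radX p i v a : i.2 != p -> off_plane p v -> levi p (radX i v a).
Proof.
move=> ip [v0 v1]; rewrite radXE; apply: leviM; first exact: levi_longX.
elim/big_rec: _ => [|j x ji Lx]; first exact: levi1.
apply: leviM => //; rewrite /planeX /plane_coord /=.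
have [->|jp] := eqVneq j p.
  by rewrite v0 v1 !shortX0 mul0r oppr0 longX0 !mulg1; apply: levi1.
have ij : i.2 != j by rewrite eq_sym.
by apply: leviM; [apply: leviM; apply: levi_shortX | apply: levi_longX].
Qed.

Lemma act_radX i v a w : off_plane i.2 v -> act (radX i v a) w = transv (e i) v a w.
Proof.
move=> vi; move: v vi a w; apply: off_plane_ind => [a w|u v ui vi IHu IHv a w|k b ki a w].
- by rewrite radX0 act_longX.
- have -> : radX i (u + v) a = (radX i u (a - sform u v) * radX i v 0)%g.
    by rewrite radXM // addr0 subrK.
  by rewrite actM IHu IHv transvM ?form_bvec_off // addr0 subrK.
have ik : i.2 != k.2 by rewrite eq_sym.
have kV : off_plane i.2 (b *: e k) by exact/off_planeZ/off_plane_bvec.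
have -> : radX i (b *: e k) a = (radX i (b *: e k) 0 * longX i a)%g.
  by rewrite -radX0 radXM // form0r !addr0 add0r.
rewrite actM radX_bvec // act_shortX // act_longX transvM ?form_bvec_off //; last exact: off_plane0.
by rewrite form0r !addr0 add0r.
Qed.

Lemma radX_sym i k b : i.2 != k.2 -> radX i (b *: e k) 0 = radX k (b *: e i) 0.
Proof.
move=> ik; have ki : k.2 != i.2 by rewrite eq_sym.
by rewrite !radX_bvec // shortX_sym.
Qed.

Lemma radXV i v a : off_plane i.2 v -> (radX i v a)^-1%g = radX i (- v) (- a).
Proof.
by move=> vi; apply: mulg1_eq; rewrite radXM // formNr sformvv oppr0 addr0 !subrr radX0 longX0.
Qed.

Lemma levi_commute p g s v a : levi p g -> s.2 = p -> off_plane p v -> act g v = v ->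
  commute g (radX s v a).
Proof.
by move=> gp sp vp gv; apply: lconj_commute; rewrite (lconj_radX _ gp) // gv.
Qed.

(** Reading the commutator the other way round: if x acts on the radical of m,
    then conjugating x by an element of that radical is also known. *)
Lemma lconj_radX_levi p x m u : levi p x -> m.2 = p -> off_plane p u ->
  lconj (radX m u 0) x = (radX m (u - act x u) (- sform u (act x u)) * x)%g.
Proof.
move=> xp mp up; have Nup : off_plane p (- u) by exact: off_planeN.
rewrite {1}/lconj -mulgA radXV ?mp // (mul_lconj x) (lconj_radX _ xp) // mulgA radXM ?mp //.
rewrite -scaleN1r actZ !scaleN1r formNr oppr0 !add0r //.
Qed.

(** As x_{-i}(v) maps e_i to w = e_i - eps_i v, [longC i v a] lifts T(w, 0, a).
    In Sp this is the product of the commuting elements T(v, 0, a),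
    T(e_i, 0, a) and T(e_i, - eps_i a v, 0), whence [liftT]; in [liftTr] the last
    two are removed on different sides.  That [liftT] and [liftTr] agree is the
    first thing to be shown. *)
Definition longC i v a : St := lconj (radX (iopp i) v 0) (longX i a).
Definition liftT i v a : St := (longC i v a * radX i ((sg i * a) *: v) (- a))%g.
Definition liftTr i v a : St := (radX i ((sg i * a) *: v) 0 * longC i v a * longX i (- a))%g.

Lemma act_lconj_longX g i a w : act (lconj g (longX i a)) w = transv (act g (e i)) 0 a w.
Proof.
rewrite /lconj !actM act_longX /transv !form0l !scaler0 !addr0 !add0r actD actZ.
have -> : sform (e i) (act g^-1%g w) = sform (act g (e i)) w.
  by rewrite -(act_form g) -actM mulgV act1.
by rewrite -actM mulgV act1.
Qed.

Lemma act_radX_opp i v : off_plane i.2 v -> act (radX (iopp i) v 0) (e i) = e i - sg i *: v.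
Proof.
move=> vi; rewrite act_radX // /transv; have [_ -> _ _] := form_off4 vi.
by rewrite !form_lin mul0r addr0 scale0r addr0 scaleNr.
Qed.

Lemma act_longC i v a w : off_plane i.2 v ->
  act (longC i v a) w = transv (e i - sg i *: v) 0 a w.
Proof. by move=> vi; rewrite act_lconj_longX act_radX_opp. Qed.

Lemma act_liftT i v a w : off_plane i.2 v -> act (liftT i v a) w = transv v 0 a w.
Proof.
move=> vi; have vi' : off_plane i.2 ((sg i * a) *: v) by exact: off_planeZ.
rewrite actM act_radX // act_longC // /transv !form_lin.
have [-> -> _ _] := form_off4 vi.
apply/ffunP => z; rewrite !ffunE /GRing.scale /=.
by ring: (sgn_sqr R i).
Qed.

Lemma levi_longC i v a p : i.2 != p -> off_plane i.2 v -> off_plane p v -> levi p (longC i v a).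
Proof.
move=> ip vi vp; rewrite /longC /lconj radXV //.
apply: leviM; [apply: leviM; [exact: levi_radX|exact: levi_longX] |].
by apply: levi_radX => //; exact: off_planeN.
Qed.

Lemma levi_liftT_neq i v a p : i.2 != p -> off_plane i.2 v -> off_plane p v -> levi p (liftT i v a).
Proof.
move=> ip vi vp; apply: leviM; first exact: levi_longC.
by apply: levi_radX => //; exact: off_planeZ.
Qed.

End Siegel.

(** * Independence of the auxiliary plane *)

Section Indep.
Variables (R : comPzRingType) (l : nat).
Local Notation St := (StSp R l).
Local Notation idx := (idx l).
Local Notation vec := (vec R l).
Local Notation sg := (@sgn R l).
Local Notation e := (@bvec R l).
Local Notation form_simp := (@sformDl R l, @sformDr R l, @sformZl R l, @sformZr R l,
  @formNl R l, @formNr R l, @sformvv R l, @form_bvec_opp R l, @form_opp_bvec R l,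
  @form0l R l, @form0r R l).
Implicit Types (i j h k m : idx) (a b c : R) (v w : vec) (g x y : St) (p : 'I_l).

Lemma off_planeZ_bvec i j c : j.2 != i.2 -> off_plane i.2 (c *: e j).
Proof. by move=> ij; apply/off_planeZ/off_plane_bvec. Qed.

Lemma transv_fix u v a (x : vec) : sform u x = 0 -> sform v x = 0 -> transv u v a x = x.
Proof. by move=> ux vx; rewrite /transv ux vx mulr0 addr0 !scale0r !addr0. Qed.

(** R4 in Heisenberg form, obtained from the action of X_{j,-j}(a) on x_i. *)
Lemma lconj_radX_longX i j a b : i.2 != j.2 ->
  lconj (radX i (b *: e (iopp j)) 0) (longX j a) =
  (radX i ((- (a * b * sg j)) *: e j) (a * b ^+ 2) * longX j a)%g.
Proof.
move=> ij; have ji : j.2 != i.2 by rewrite eq_sym.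
have jL : levi i.2 (longX j a) by apply: levi_longX.
rewrite (lconj_radX_levi jL) //; last exact: off_planeZ_bvec.
rewrite act_longX /transv !form_simp; congr (radX _ _ _ * _)%g.
  by apply/ffunP => z; rewrite !ffunE /GRing.scale /=; ring.
by ring: (sgn_sqr R j).
Qed.

(** By R4, X_{i,-i}(a b^2) is a product of an element of x_i, a conjugate of
    X_{j,-j}(a) by g = x_i(b e_{-j}), and X_{j,-j}(- a).  Conjugate this by x_{-i}(v),
    which normalises x_j: the middle factor becomes a conjugate of [longC j]. *)
Lemma liftT_swap i j v a b : i.2 != j.2 -> off_plane i.2 v -> off_plane j.2 v ->
  liftT i v (a * b ^+ 2) = liftTr j ((- (b * sg i)) *: v) a.
Proof.
move=> ij vi vj; have ji : j.2 != i.2 by rewrite eq_sym.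
set c := a * b * sg j; set v' := (- (b * sg i)) *: v.
have v'i : off_plane i.2 v' by exact: off_planeZ.
have v'j : off_plane j.2 v' by exact: off_planeZ.
set g := radX i (b *: e (iopp j)) 0.
have iV d : off_plane i.2 (d *: e j) by apply: off_planeZ_bvec.
have iV' d : off_plane i.2 (d *: e (iopp j)) by apply: off_planeZ_bvec.
have jV d : off_plane j.2 (d *: e i) by apply: off_planeZ_bvec.
have vZi d : off_plane i.2 (d *: v) by exact: off_planeZ.
have vZj d : off_plane j.2 (d *: v) by exact: off_planeZ.
have [ev ve ev' ve'] := form_off4 vi.
have [fv vf fv' vf'] := form_off4 vj.
have [ee ee' ee'' ee'''] := form_planes4 R ij.
have [ff ff' ff'' ff'''] := form_planes4 R ji.
(* X_{i,-i}(a b^2) isolated from lconj_radX_longX *)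
have lgE : longX i (a * b ^+ 2) = (radX i (c *: e j) 0 * lconj g (longX j a) * longX j (- a))%g.
  rewrite lconj_radX_longX // !mulgA -(mulgA _ (longX j a)) longXD subrr longX0 mulg1 radXM //.
  by rewrite -scalerDl subrr scale0r !form_simp !mulr0 addr0 add0r radX0.
pose h := radX (iopp i) v 0.
have hL : levi j.2 h by apply: levi_radX.
have hE d : lconj h (radX i (d *: e j) 0) = (radX j (d *: e i) 0 * radX j ((- (d * sg i)) *: v) 0)%g.
  rewrite radX_sym // (lconj_radX _ hL) //.
  rewrite actZ act_radX_opp // radXM // !form_simp ev !mulr0 !addr0.
  by congr radX; apply/ffunP => z; rewrite !ffunE /GRing.scale /=; ring.
have gE : lconj h g = (g * radX (iopp j) v' 0)%g.
  rewrite /g radX_sym // (lconj_radX _ hL) //.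
  rewrite actZ act_radX_opp // radXM // !form_simp ev !mulr0 !addr0.
  by congr radX; apply/ffunP => z; rewrite !ffunE /GRing.scale /=; ring.
have PE : longC i v (a * b ^+ 2) =
    (radX j (c *: e i) 0 * radX j ((- (c * sg i)) *: v) 0 * lconj g (longC j v' a) * longX j (- a))%g.
  have cjcj z : lconj h (lconj g z) = lconj (lconj h g) (lconj h z).
    by rewrite /lconj !invgM invgK !mulgA !mulgVK.
  have hj b' : lconj h (longX j b') = longX j b'.
    by rewrite -radX0 (lconj_radX _ hL) ?act0 //; apply: off_plane0.
  by rewrite /longC -/h lgE 2!lconjM hE cjcj !hj gE lconjMl.
have PL : levi i.2 (longC j v' a) by apply: levi_longC.
have gP : lconj g (longC j v' a) =
    (radX i ((- c) *: e j) (a * b ^+ 2) * radX i ((- (sg i * (a * b ^+ 2))) *: v) 0 * longC j v' a)%g.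
  rewrite /g (lconj_radX_levi PL) // act_longC // radXM // /transv /v' !form_simp vf'; congr (radX _ _ _ * _)%g.
    by apply/ffunP => z; rewrite !ffunE /GRing.scale /= /c; ring: (sgn_sqr R j).
  by rewrite fv fv' /c; ring: (sgn_sqr R j).
rewrite /liftT PE gP -[LHS]mulgA.
set u := sg i * (a * b ^+ 2).
have C1 : commute (longX j (- a)) (radX i (u *: v) (- (a * b ^+ 2))).
  apply: (levi_commute _ (levi_longX (- a) ji)) => //.
  by rewrite act_longX transv_fix // !form_simp ?fv ?mulr0.
have C2 : commute (longC j v' a) (radX i (u *: v) (- (a * b ^+ 2))).
  apply: (levi_commute _ PL) => //.
  rewrite act_longC // transv_fix ?form0l // /v' !form_simp fv; ring.
have mv (A B C D P L U : St) : commute L U -> commute P U ->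
    (A * B * (C * D * P) * (L * U) = A * (B * (C * D * U)) * P * L)%g.
  by move=> LU PU; rewrite LU !mulgA -[(_ * P * U)%g]mulgA PU !mulgA.
rewrite mv // {mv C1 C2}.
have -> : (radX i ((- c) *: e j) (a * b ^+ 2) * radX i (- u *: v) 0 *
    radX i (u *: v) (- (a * b ^+ 2)) = radX j ((- c) *: e i) 0)%g.
  rewrite -mulgA [in X in (_ * X)%g]radXM // radXM // -radX_sym //; congr radX.
    by rewrite -scalerDl addNr scale0r addr0.
  by rewrite !form_simp fv; ring.
rewrite /liftTr radXM // radXM //.
congr (radX _ _ _ * _ * _)%g.
  by apply/ffunP => z; rewrite !ffunE /GRing.scale /= /c; ring.
by rewrite !form_simp ve ev; ring.
Qed.

Lemma liftT_liftTr_neq i j v a : i.2 != j.2 -> off_plane i.2 v -> off_plane j.2 v -> liftT i v a = liftTr j v a.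
Proof.
move=> ij vi vj; have := liftT_swap a (- sg i) ij vi vj.
by rewrite mulNr sgn_sqr opprK scale1r sqrrN expr2 sgn_sqr mulr1.
Qed.

(** Z_j(v, a) equals [liftTr i v a] and acts on the radical of i, so it commutes
    with x_i(v); therefore the factor x_i(eps_i a v) may change sides. *)
Lemma liftT_liftTr i j v a : i.2 != j.2 -> off_plane i.2 v -> off_plane j.2 v -> liftT i v a = liftTr i v a.
Proof.
move=> ij vi vj; have ji : j.2 != i.2 by rewrite eq_sym.
have vZi d : off_plane i.2 (d *: v) by exact: off_planeZ.
have C : commute (liftT j v a) (radX i ((sg i * a) *: v) 0).
  apply: (levi_commute _ (levi_liftT_neq a ji vj vi)) => //.
  by rewrite act_liftT // transv_fix // !form_simp ?mulr0.
rewrite (liftT_liftTr_neq _ ji) // in C.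
apply: (@mulgI _ (radX i ((sg i * a) *: v) 0)).
have E : radX i ((sg i * a) *: v) (- a) = (longX i (- a) * radX i ((sg i * a) *: v) 0)%g.
  by rewrite -radX0 radXM ?form0l ?addr0 ?add0r //; exact: off_plane0.
by rewrite -[RHS]C /liftT /liftTr E !mulgA.
Qed.

Lemma liftT_indep i j v a : i.2 != j.2 -> off_plane i.2 v -> off_plane j.2 v -> liftT i v a = liftT j v a.
Proof.
move=> ij vi vj; have ji : j.2 != i.2 by rewrite eq_sym.
by rewrite (liftT_liftTr a ij) // (liftT_liftTr_neq a ji).
Qed.

(** The sign in b is immaterial, since only b^2 occurs on the left. *)
Lemma liftT_sqr i j v a b : i.2 != j.2 -> off_plane i.2 v -> off_plane j.2 v ->
  liftT i v (a * b ^+ 2) = liftT i (b *: v) a.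
Proof.
move=> ij vi vj; have ji : j.2 != i.2 by rewrite eq_sym.
have vZi d : off_plane i.2 (d *: v) by exact: off_planeZ.
have vZj d : off_plane j.2 (d *: v) by exact: off_planeZ.
have -> : b ^+ 2 = (- (b * sg i)) ^+ 2 by ring: (sgn_sqr R i).
rewrite (liftT_swap _ _ ij) // -(liftT_liftTr_neq _ ij) //.
by rewrite mulNr -mulrA sgn_sqr mulr1 opprK.
Qed.

(** For p the plane of i itself this needs the independence of i. *)
Lemma levi_liftT i j v a p : i.2 != j.2 -> off_plane i.2 v -> off_plane j.2 v -> off_plane p v ->
  levi p (liftT i v a).
Proof.
move=> ij vi vj vp; have [ip|ip] := eqVneq i.2 p; last exact: levi_liftT_neq.
by rewrite (liftT_indep a ij) //; apply: levi_liftT_neq => //; rewrite -ip eq_sym.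
Qed.

End Indep.

(** * Lifts of T(s, w, 0) for s in a plane and w off it *)

Section Mixed.
Variables (R : comPzRingType) (l : nat).
Local Notation St := (StSp R l).
Local Notation idx := (idx l).
Local Notation vec := (vec R l).
Local Notation sg := (@sgn R l).
Local Notation e := (@bvec R l).
Local Notation form_simp := (@sformDl R l, @sformDr R l, @sformZl R l, @sformZr R l,
  @formNl R l, @formNr R l, @sformvv R l, @form_bvec_opp R l, @form_opp_bvec R l,
  @form0l R l, @form0r R l).
Implicit Types (i j h k m : idx) (a b c q r : R) (v w : vec) (g x y : St) (p : 'I_l).

Lemma radX_longX i v a b : off_plane i.2 v -> (radX i v a * longX i b)%g = radX i v (a + b).
Proof. by move=> vi; rewrite -(radX0 i b) radXM // (form0r v) !addr0. Qed.

Lemma longX_radX i v a b : (longX i b * radX i v a)%g = radX i v (b + a).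
Proof. by rewrite -(radX0 i b) radXM ?(form0l v) ?addr0 ?add0r //; exact: off_plane0. Qed.

Lemma act_liftT_fix i v a w : off_plane i.2 v -> sform v w = 0 -> act (liftT i v a) w = w.
Proof. by move=> vi vw; rewrite act_liftT // transv_fix // (form0l w). Qed.

(** The vector q e_i + r e_{-i}; locked to keep unification fast. *)
Fact plane_vec_key : unit. Proof. exact: tt. Qed.
Definition plane_vec i q r : vec := locked_with plane_vec_key (q *: e i + r *: e (iopp i)).
Lemma plane_vecE i q r : plane_vec i q r = q *: e i + r *: e (iopp i).
Proof. by rewrite /plane_vec unlock. Qed.

Lemma off_plane_vec i p q r : i.2 != p -> off_plane p (plane_vec i q r).
Proof. by move=> ip; rewrite plane_vecE; apply: off_planeD; apply/off_planeZ/off_plane_bvec. Qed.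

Lemma form_plane_vec i q r v : off_plane i.2 v -> sform (plane_vec i q r) v = 0.
Proof. by move=> vi; rewrite !plane_vecE !form_simp !form_bvec_off // !mulr0 addr0. Qed.

Lemma form_plane_vecr i q r v : off_plane i.2 v -> sform v (plane_vec i q r) = 0.
Proof. by move=> vi; rewrite sformC form_plane_vec // oppr0. Qed.

Lemma plane_vecZ i a q r : a *: plane_vec i q r = plane_vec i (a * q) (a * r).
Proof. by rewrite !plane_vecE scalerDr !scalerA. Qed.

(** In Sp one has T(s, w, 0) = T(e_i, q w, 0) T(e_{-i}, r w, 0) T(w, 0, - eps_i q r)
    for s = q e_i + r e_{-i}, the last factor making up for
    <q e_i, r e_{-i}> = eps_i q r. *)
Fact mixT_key : unit. Proof. exact: tt. Qed.
Definition mixT i q r w : St := locked_with mixT_key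
  (radX i (q *: w) 0 * radX (iopp i) (r *: w) 0 * liftT i w (- (sg i * q * r)))%g.
Lemma mixTE i q r w : mixT i q r w =
  (radX i (q *: w) 0 * radX (iopp i) (r *: w) 0 * liftT i w (- (sg i * q * r)))%g.
Proof. by rewrite /mixT unlock. Qed.

Lemma act_mixT i q r w v : off_plane i.2 w -> act (mixT i q r w) v = transv (plane_vec i q r) w 0 v.
Proof.
move=> wi; have wZ d : off_plane i.2 (d *: w) by exact: off_planeZ.
rewrite mixTE 2!actM !act_radX // act_liftT // /transv !plane_vecE !form_simp.
have [ew we ew' we'] := form_off4 wi; rewrite ?ew ?we ?ew' ?we'.
apply/ffunP => z; rewrite !ffunE /GRing.scale /=; ring: (sgn_sqr R i).
Qed.

Lemma levi_mixT i q r w p : i.2 != p -> off_plane i.2 w -> off_plane p w -> levi p (mixT i q r w).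
Proof.
move=> ip wi wp; rewrite mixTE; apply: leviM; last exact: levi_liftT_neq.
by apply: leviM; apply: levi_radX => //; apply: off_planeZ.
Qed.

Lemma lconj_liftT i g w a : levi i.2 g -> off_plane i.2 w -> lconj g (liftT i w a) = liftT i (act g w) a.
Proof.
move=> gi wi; have wZ d : off_plane i.2 (d *: w) by exact: off_planeZ.
have gl : lconj g (longX i a) = longX i a by rewrite -radX0 (lconj_radX _ gi) ?act0 //; exact: off_plane0.
have cjcj x y : lconj g (lconj x y) = lconj (lconj g x) (lconj g y).
  by rewrite /lconj !invgM invgK !mulgA !mulgVK.
by rewrite lconjM cjcj gl !(lconj_radX _ gi) // actZ.
Qed.

Lemma lconj_mixT i g q r w : levi i.2 g -> off_plane i.2 w ->
  lconj g (mixT i q r w) = mixT i q r (act g w).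
Proof.
move=> gi wi; have wZ d : off_plane i.2 (d *: w) by exact: off_planeZ.
by rewrite !mixTE lconjM lconj_liftT // lconjM !(lconj_radX _ gi) // !actZ.
Qed.

(** T(s, w, 0) for s in the plane of j is also the commutator of T(e_{-i}, w, 0)
    with T(e_i, - eps_i s, 0).  The same holds in StSp: conjugate the factors
    x_i(e_j), x_i(e_{-j}), X_{i,-i} of x_i(s) separately, using that x_i(c e_j)
    is also x_j(c e_i) on which x_{-i}(w) acts, and collect the results. *)
Lemma lconj_radX_plane_vec i j q r w : i.2 != j.2 -> off_plane i.2 w -> off_plane j.2 w ->
  lconj (radX (iopp i) w 0) (radX i (- sg i *: plane_vec j q r) 0) =
  (mixT j q r w * radX i (- sg i *: plane_vec j q r) 0)%g.
Proof.
move=> ij wi wj; have ji : j.2 != i.2 by rewrite eq_sym.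
have wZi d : off_plane i.2 (d *: w) by exact: off_planeZ.
have wZj d : off_plane j.2 (d *: w) by exact: off_planeZ.
have iV d : off_plane i.2 (d *: e j) by apply: off_planeZ_bvec.
have iV' d : off_plane i.2 (d *: e (iopp j)) by apply: off_planeZ_bvec.
have jV d : off_plane j.2 (d *: e i) by apply: off_planeZ_bvec.
have tV d q' r' : off_plane i.2 (d *: plane_vec j q' r') by apply/off_planeZ/off_plane_vec.
have [ew we ew' we'] := form_off4 wi.
have [fw wf fw' wf'] := form_off4 wj.
have ff' : sform (e j) (e (iopp j)) = sg j by exact: form_bvec_opp.
set c := - (sg j * q * r); set d := - (sg i * q); set d' := - (sg i * r).
have hL : levi j.2 (radX (iopp i) w 0) by apply: levi_radX.
have -> : radX i (- sg i *: plane_vec j q r) 0 =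
    (radX i (d *: e j) 0 * radX i (d' *: e (iopp j)) 0 * longX i c)%g.
  rewrite radXM // radX_longX; last exact: off_planeD.
  rewrite !plane_vecE scalerDr !scalerA !add0r; congr radX; first by rewrite /d /d' !mulNr.
  by rewrite !form_simp /c /d /d'; ring: (sgn_sqr R i).
have hE s u : s.2 = j.2 -> lconj (radX (iopp i) w 0) (radX i (u *: e s) 0) =
    (radX i (u *: e s) 0 * radX s ((- (sg i * u)) *: w) 0)%g.
  move=> sj; have is_ : i.2 != s.2 by rewrite sj.
  have sV t : off_plane s.2 (t *: e i) by rewrite sj.
  have wS t : off_plane s.2 (t *: w) by rewrite sj.
  rewrite radX_sym // (lconj_radX _ hL) // ?sj // actZ act_radX_opp // radXM //.
  rewrite !form_simp ew !mulr0 !addr0; congr radX.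
  by apply/ffunP => z; rewrite !ffunE /GRing.scale /=; ring.
rewrite 2!lconjM !hE //.
have -> : lconj (radX (iopp i) w 0) (longX i c) = (liftT j w c * radX i ((- (sg i * c)) *: w) c)%g.
  rewrite -(liftT_indep c ij) // -mulgA radXM // !form_simp -scalerDl subrr scale0r.
  by rewrite addNr !mulr0 addr0 radX0 longX0 mulg1.
have -> : - (sg i * d) = q by rewrite /d; ring: (sgn_sqr R i).
have -> : - (sg i * d') = r by rewrite /d'; ring: (sgn_sqr R i).
have yL : levi i.2 (mixT j q r w) by apply: levi_mixT.
have yw : act (mixT j q r w) w = w.
  by rewrite act_mixT // transv_fix // ?sformvv // form_plane_vec.
have yt : act (mixT j q r w) (plane_vec j q r) = plane_vec j q r.
  by rewrite act_mixT // transv_fix // ?sformvv // form_plane_vecr.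
set C' := radX i (d' *: e (iopp j) + (sg i * c) *: w) 0.
have BC : (radX j (q *: w) 0 * radX i (d' *: e (iopp j)) 0 = C' * radX j (q *: w) 0)%g.
  have xL : levi i.2 (radX j (q *: w) 0) by apply: levi_radX.
  rewrite mul_lconj (lconj_radX _ xL) // act_radX // /transv !form_simp wf'; congr (radX _ _ _ * _)%g.
  by apply/ffunP => z; rewrite !ffunE /GRing.scale /= /c /d'; ring.
set F := radX i (- sg i *: plane_vec j q r + (sg i * c) *: w) (- c).
have AC : (radX i (d *: e j) 0 * C' = F)%g.
  rewrite /C' /F radXM //; congr radX.
    apply/ffunP => z; rewrite !plane_vecE !ffunE /GRing.scale /= /d /d'; ring.
  by rewrite !form_simp fw /c /d /d'; ring: (sgn_sqr R i).
have yF : commute (mixT j q r w) F.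
  apply: (levi_commute _ yL) => //; first by apply: off_planeD.
  by rewrite actD !actZ yw yt.
have mv (A B C D Z U W : St) : (B * C = C' * B -> A * C' = F ->
    B * D * Z = mixT j q r w -> F * U = A * C * W ->
    A * B * (C * D) * (Z * U) = mixT j q r w * (A * C * W))%g.
  move=> e1 e2 e3 e4; rewrite -[(A * B * _)%g]mulgA [(B * (C * D))%g]mulgA e1.
  rewrite -e4 [RHS]mulgA yF -e2 -e3 !mulgA //.
apply: mv => //; first by rewrite mixTE.
rewrite /F radXM; last exact: off_planeD.
rewrite radXM // radX_longX; last exact: off_planeD.
congr radX; last first.
  by rewrite !plane_vecE !form_simp ?fw ?fw' /c /d /d'; ring: (sgn_sqr R i).
by apply/ffunP => z; rewrite !plane_vecE !ffunE /GRing.scale /= /d /d'; ring.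
Qed.

Lemma mixT_fix_plane i j q r w : i.2 != j.2 -> off_plane i.2 w -> off_plane j.2 w ->
  act (mixT j q r w) (plane_vec j q r) = plane_vec j q r.
Proof. by move=> ij wi wj; rewrite act_mixT // transv_fix ?sformvv ?form_plane_vecr. Qed.

Lemma mixT_fix j q r w : off_plane j.2 w -> act (mixT j q r w) w = w.
Proof. by move=> wj; rewrite act_mixT // transv_fix ?sformvv // form_plane_vec. Qed.

Lemma mixT_lcomm i j q r w : i.2 != j.2 -> off_plane i.2 w -> off_plane j.2 w ->
  mixT j q r w = lcomm (radX (iopp i) w 0) (radX i (- sg i *: plane_vec j q r) 0).
Proof. by move=> ij wi wj; rewrite lcomm_lconj lconj_radX_plane_vec // mulgK. Qed.

Lemma mixTN i j q r w : i.2 != j.2 -> off_plane i.2 w -> off_plane j.2 w ->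
  mixT j (- q) (- r) w = (mixT j q r w)^-1%g.
Proof.
move=> ij wi wj; have ji : j.2 != i.2 by rewrite eq_sym.
have tV : off_plane i.2 (- sg i *: plane_vec j q r) by apply/off_planeZ/off_plane_vec.
have yL : levi i.2 (mixT j (- q) (- r) w) by apply: levi_mixT.
have := lcommMr (radX (iopp i) w 0) (radX i (- sg i *: plane_vec j q r) 0)
               (radX i (- sg i *: plane_vec j (- q) (- r)) 0).
have hvN : - plane_vec j q r = plane_vec j (- q) (- r) by rewrite -scaleN1r plane_vecZ !mulN1r.
rewrite -!mixT_lcomm // -hvN scalerN radXM // form_simp sformvv oppr0 !addr0 subrr radX0 longX0.
rewrite lconj_fix; last first.
  apply/commute_sym/(levi_commute _ yL) => //.
  by rewrite actZ -[plane_vec j q r]opprK hvN -scaleN1r actZ (@mixT_fix_plane i).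
by rewrite lcommE mulg1 mulgV mul1g invg1 => /esym/mulg1_eq.
Qed.

Lemma mixTZ i j q r a w : i.2 != j.2 -> off_plane i.2 w -> off_plane j.2 w ->
  mixT j q r (a *: w) = mixT j (a * q) (a * r) w.
Proof.
move=> ij wi wj; have ji : j.2 != i.2 by rewrite eq_sym.
rewrite !mixTE -(liftT_sqr _ _ ji) // !scalerA [q * a]mulrC [r * a]mulrC.
by congr (_ * liftT _ _ _)%g; ring.
Qed.

(** Exchanging k with -k in [mixT_lcomm] exchanges the two arguments of the
    commutator, that is, the roles of i and j. *)
Lemma mixT_sym k i j q r q' r' : k.2 != i.2 -> k.2 != j.2 -> i.2 != j.2 ->
  mixT i q r (plane_vec j q' r') = mixT j q' r' (plane_vec i q r).
Proof.
move=> ki kj ij; pose k0 : idx := (false, k.2).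
have ki0 : k0.2 != i.2 by [].
have kj0 : k0.2 != j.2 by [].
have ji : j.2 != i.2 by rewrite eq_sym.
have tk : off_plane k.2 (plane_vec j q' r') by apply: off_plane_vec; rewrite eq_sym.
have ti : off_plane i.2 (plane_vec j q' r') by apply: off_plane_vec.
have sk : off_plane k.2 (plane_vec i q r) by apply: off_plane_vec; rewrite eq_sym.
have sj : off_plane j.2 (plane_vec i q r) by apply: off_plane_vec.
apply: invg_inj; rewrite -(mixTN q r ki0 tk ti) (mixT_lcomm (- q) (- r) ki0 tk ti).
rewrite (@mixT_lcomm (iopp k0) j q' r' (plane_vec i q r)) // lcommV ioppK sgn_opp opprK.
by rewrite [sg k0]/sgn /= scale1r !plane_vecZ !mulN1r !opprK.
Qed.

(** Conjugate X_{i,-i}(a) first by x_{-i}(t), t = q e_j + r e_{-j}, then by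
    x_{-i}(w); the second conjugation fixes Z_i(t, a) and acts on the remaining
    factor x_i(- eps_i a t) by [lconj_radX_plane_vec]. *)
Lemma liftT_add k i j a q r w : i.2 != k.2 -> j.2 != k.2 -> i.2 != j.2 ->
  off_plane i.2 w -> off_plane j.2 w ->
  liftT i (plane_vec j q r + w) a = (liftT i (plane_vec j q r) a * mixT j (a * q) (a * r) w * liftT i w a)%g.
Proof.
move=> ik jk ij wi wj; have ji : j.2 != i.2 by rewrite eq_sym.
set t := plane_vec j q r.
have ti : off_plane i.2 t by apply: off_plane_vec.
have tk : off_plane k.2 t by apply: off_plane_vec.
have tZ d : off_plane i.2 (d *: t) by exact: off_planeZ.
have wZ d : off_plane i.2 (d *: w) by exact: off_planeZ.
have tw : sform t w = 0 by apply: form_plane_vec.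
have wt : sform w t = 0 by apply: form_plane_vecr.
have ZtL : levi i.2 (liftT i t a) by apply: (levi_liftT _ ik).
have ZwL : levi i.2 (liftT i w a) by apply: (levi_liftT _ ij).
have PE u : off_plane i.2 u -> longC i u a = (liftT i u a * radX i (- (sg i * a) *: u) a)%g.
  move=> ui; have uZ d : off_plane i.2 (d *: u) by exact: off_planeZ.
  rewrite /liftT -mulgA radXM // !form_simp -scalerDl subrr scale0r !mulr0 addr0 addNr.
  by rewrite radX0 longX0 mulg1.
have PtwE : longC i (t + w) a = lconj (radX (iopp i) w 0) (longC i t a).
  by rewrite /longC -lconjMl radXM // wt !addr0 addrC.
have hZ : lconj (radX (iopp i) w 0) (liftT i t a) = liftT i t a.
  apply/lconj_fix/commute_sym/(levi_commute _ ZtL) => //.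
  exact: act_liftT_fix.
have xE : radX i (- (sg i * a) *: t) a = (radX i (- sg i *: plane_vec j (a * q) (a * r)) 0 * longX i a)%g.
  rewrite radX_longX ?add0r; last exact/off_planeZ/off_plane_vec.
  by rewrite -plane_vecZ scalerA mulNr.
rewrite {1}/liftT PtwE PE // lconjM hZ xE lconjM lconj_radX_plane_vec // -/(longC i w a) PE //.
set Y := mixT _ _ _ _; set x := radX i (- sg i *: _) 0.
have -> : x = radX i (- (sg i * a) *: t) 0 by rewrite /x -plane_vecZ scalerA mulNr.
have C : commute (liftT i w a) (radX i (- (sg i * a) *: t) 0).
  apply: (levi_commute _ ZwL) => //.
  by rewrite actZ act_liftT_fix.
have mv (A B X Z U V : St) : commute Z X -> (X * U * V = 1)%g ->
    (A * (B * X * (Z * U)) * V = A * B * Z)%g.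
  move=> ZX e1; rewrite -[(B * X * _)%g]mulgA [(X * (Z * U))%g]mulgA -ZX.
  by rewrite -!mulgA [(X * _)%g]mulgA e1 mulg1.
clearbody t; apply: mv => //; rewrite radXM // radXM //; last exact: off_planeD.
rewrite !form_simp tw wt !mulr0 !addr0 add0r subrr.
rewrite -[RHS](longX0 R i) -radX0; congr radX.
  by rewrite -scalerDr scaleNr addNr.
by rewrite !mulr0 !addr0.
Qed.

(** The factors x_i(q w) and x_{-i}(r t) do not commute; their commutator is
    cancelled by the mixed term of Z_i(t + w, - eps_i q r) in [liftT_add]. *)
Lemma mixT_add k i j q r q' r' w : i.2 != k.2 -> j.2 != k.2 -> i.2 != j.2 ->
  off_plane i.2 w -> off_plane j.2 w ->
  mixT i q r (plane_vec j q' r' + w) = (mixT i q r (plane_vec j q' r') * mixT i q r w)%g.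
Proof.
move=> ik jk ij wi wj; have ji : j.2 != i.2 by rewrite eq_sym.
set t := plane_vec j q' r'; set c := - (sg i * q * r).
have ti : off_plane i.2 t by apply: off_plane_vec.
have tk : off_plane k.2 t by apply: off_plane_vec.
have tZ d : off_plane i.2 (d *: t) by exact: off_planeZ.
have wZ d : off_plane i.2 (d *: w) by exact: off_planeZ.
have wZj d : off_plane j.2 (d *: w) by exact: off_planeZ.
have tw : sform t w = 0 by apply: form_plane_vec.
have wt : sform w t = 0 by apply: form_plane_vecr.
have xD (s : idx) d : s.2 = i.2 ->
    radX s (d *: (t + w)) 0 = (radX s (d *: t) 0 * radX s (d *: w) 0)%g.
  by clearbody t; move=> si; rewrite radXM ?si // !form_simp tw !mulr0 !addr0 scalerDr.
rewrite (mixTE _ _ _ (_ + _)) !xD // (liftT_add _ _ _ ik jk) //.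
set Y := mixT j (c * q') (c * r') w.
have YL d d' : levi i.2 (mixT j d d' w) by apply: levi_mixT.
(* the price of exchanging x_i(q w) and x_{-i}(r t), by mixT_lcomm *)
have Ysw : (radX i (q *: w) 0 * radX (iopp i) (r *: t) 0 =
    Y^-1 * radX (iopp i) (r *: t) 0 * radX i (q *: w) 0)%g.
  rewrite mul_lconj; congr (_ * _)%g.
  have -> : radX (iopp i) (r *: t) 0 = radX (iopp i) (- sg (iopp i) *: plane_vec j (sg i * r * q') (sg i * r * r')) 0.
    have sgK a : sg i * (sg i * r * a) = r * a by rewrite !mulrA sgn_sqr mul1r.
    by rewrite /t plane_vecZ sgn_opp opprK plane_vecZ !sgK.
  rewrite -{1}[i in radX i (q *: w)]ioppK lconj_radX_plane_vec //; congr (_ * _)%g.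
  rewrite (mixTZ _ _ q ij wi wj) -(mixTN (c * q') (c * r') ij wi wj).
  have cE a : q * (sg i * r * a) = - (c * a) by rewrite /c; ring.
  by rewrite !cE.
have Yw s d a : s.2 = i.2 -> commute Y (radX s (d *: w) a).
  move=> si; apply: (levi_commute _ (YL _ _)) => //.
  by rewrite actZ mixT_fix.
have ZtL : levi i.2 (liftT i t c) by apply: (levi_liftT _ ik).
have Zw s d a : s.2 = i.2 -> commute (liftT i t c) (radX s (d *: w) a).
  move=> si; apply: (levi_commute _ ZtL) => //.
  by rewrite actZ act_liftT_fix.
have ZY : commute (liftT i t c) Y.
  apply: lconj_commute; rewrite /Y (mixT_lcomm _ _ ij) // lconjR.
  rewrite !(lconj_radX _ ZtL) //; last exact/off_planeZ/off_plane_vec.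
  have tt : sform t t = 0 by apply: sformvv.
  by rewrite -(plane_vecZ j c q' r') -/t !actZ !act_liftT_fix.
rewrite !mixTE -/c.
have mv (A B C D Z E : St) : (B * C = Y^-1 * C * B -> commute Y B -> commute Y D ->
   commute Y C -> commute Z B -> commute Z D -> commute Z Y -> 
   A * B * (C * D) * (Z * Y * E) = A * C * Z * (B * D * E))%g.
  move=> e1 YB YD YC ZB ZD ZY'.
  rewrite -[(A * B * _)%g]mulgA [(B * (C * D))%g]mulgA e1.
  rewrite -!mulgA; congr (_ * _)%g.
  have YVC := commuteVl YC; have YVB := commuteVl YB; have YVD := commuteVl YD.
  rewrite [(Y^-1 * _)%g]mulgA YVC -!mulgA; congr (_ * _)%g.
  rewrite [(D * _)%g]mulgA -ZD -!mulgA [(B * (Z * _))%g]mulgA -ZB -!mulgA.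
  rewrite [(Y^-1 * _)%g]mulgA -(commuteV ZY') -!mulgA; congr (_ * _)%g.
  rewrite [(D * (Y * _))%g]mulgA -YD -!mulgA [(B * (Y * _))%g]mulgA -YB -!mulgA.
  by rewrite mulKg.
apply: mv => //; try by apply: Yw.
- apply: (levi_commute _ (YL _ _)) => //.
  by rewrite actZ act_mixT // -plane_vecZ transv_fix ?sformZl ?sformvv ?mulr0.
- exact: Zw.
- exact: Zw.
Qed.

End Mixed.

(** * Lifts of all T(u, 0, a), and centrality *)

Section Central.
Variables (R : comPzRingType) (l : nat).
Hypothesis hl : (4 <= l)%N.
Local Notation St := (StSp R l).
Local Notation idx := (idx l).
Local Notation vec := (vec R l).
Local Notation sg := (@sgn R l).
Local Notation e := (@bvec R l).
Implicit Types (i j h k m n : idx) (a b c q r : R) (u v w : vec) (g x y : St) (p : 'I_l).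

Lemma liftT_plane_vec i k k' q r a : k.2 != i.2 -> k'.2 != i.2 ->
  liftT k (plane_vec i q r) a = liftT k' (plane_vec i q r) a.
Proof.
move=> ki k'i; have H n : n.2 != i.2 -> off_plane n.2 (plane_vec i q r).
  by move=> ni; apply: off_plane_vec; rewrite eq_sym.
have [n [ni nk nk']] := plane3 i.2 k.2 k'.2 hl.
by rewrite -(liftT_indep a nk) ?(liftT_indep a nk') //; apply: H.
Qed.

Definition off_part i u : vec := u - @plane_vec R l i (u i) (u (iopp i)).

Lemma plane_vec_coord i q r : (plane_vec i q r) i = q /\ (plane_vec i q r) (iopp i) = r.
Proof.
rewrite !plane_vecE !ffunE /GRing.scale /= !eqxx [iopp i == i]eq_sym (negPf (iopp_neq i)) /=.
by rewrite !mulr0 !mulr1 addr0 add0r.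
Qed.

Lemma off_planeP i v : off_plane i.2 v <-> v i = 0 /\ v (iopp i) = 0.
Proof. by case: i => [[] p]; split=> -[]. Qed.

Lemma off_plane_off_part i u : off_plane i.2 (off_part i u).
Proof.
apply/off_planeP; have [h0 h1] := plane_vec_coord i (u i) (u (iopp i)).
by rewrite /off_part; split; rewrite 2!ffunE ?h0 ?h1 subrr.
Qed.

Lemma vec_split i u : u = @plane_vec R l i (u i) (u (iopp i)) + off_part i u.
Proof. by rewrite /off_part addrC subrK. Qed.

(** For u = s + v, s in the plane of i and v off it, T(u, 0, a) is the product of
    T(s, 0, a), T(a s, v, 0) and T(v, 0, a).  The first factor is lifted by means
    of any plane k other than that of i. *)
Fact fullT_key : unit. Proof. exact: tt. Qed.
Definition fullT k i u a : St := locked_with fullT_key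
  (@liftT R l k (@plane_vec R l i (u i) (u (iopp i))) a * @mixT R l i (a * u i) (a * u (iopp i)) (off_part i u)
   * liftT i (off_part i u) a)%g.

Lemma fullTE k i q r v a : off_plane i.2 v ->
  fullT k i (plane_vec i q r + v) a =
  (liftT k (plane_vec i q r) a * mixT i (a * q) (a * r) v * liftT i v a)%g.
Proof.
move=> /[dup] vi /off_planeP[v0 v1]; have [h0 h1] := plane_vec_coord i q r.
have E0 : (plane_vec i q r + v) i = q by rewrite ffunE h0 v0 addr0.
have E1 : (plane_vec i q r + v) (iopp i) = r by rewrite ffunE h1 v1 addr0.
by rewrite /fullT unlock /off_part E0 E1 [plane_vec i q r + v]addrC addrK.
Qed.

(** Split u as s + t + w along the planes of i and j.  By [mixT_add] and [liftT_add]
    both sides are products of the same six elements, lifting T(s, 0, a),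
    T(t, 0, a), T(w, 0, a), T(a s, t, 0), T(a s, w, 0) and T(a t, w, 0).  These
    commute when they have to, since each acts on a suitable radical through
    Sp and fixes the vectors defining the other one. *)
Lemma fullT_indep k i j u a : k.2 != i.2 -> k.2 != j.2 -> i.2 != j.2 ->
  fullT k i u a = fullT k j u a.
Proof.
move=> ki kj ij; have ji : j.2 != i.2 by rewrite eq_sym.
have ik : i.2 != k.2 by rewrite eq_sym.
have jk : j.2 != k.2 by rewrite eq_sym.
pose v := off_part i u; pose w := off_part j v.
pose q : R := u i; pose r : R := u (iopp i); pose q' : R := v j; pose r' : R := v (iopp j).
have uE : u = plane_vec i q r + (plane_vec j q' r' + w) by rewrite -vec_split -vec_split.
have wj : off_plane j.2 w by apply: off_plane_off_part.
have wi : off_plane i.2 w.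
  by apply: off_planeD; [apply: off_plane_off_part | apply/off_planeN/off_plane_vec].
rewrite uE {uE}; clearbody w q r q' r'; clear v.
have si : forall p, i.2 != p -> off_plane p (plane_vec i q r) by move=> *; apply: off_plane_vec.
have ti : forall p, j.2 != p -> off_plane p (plane_vec j q' r') by move=> *; apply: off_plane_vec.
rewrite fullTE; last by apply: off_planeD => //; apply: ti.
rewrite [plane_vec i q r + _]addrCA fullTE; last by apply: off_planeD => //; apply: si.
rewrite (mixT_add (a * q) (a * r) q' r' ik jk ij wi wj).
rewrite (liftT_add a q' r' ik jk ij wi wj).
rewrite (mixT_add (a * q') (a * r') q r jk ik ji wj wi).
rewrite (liftT_add a q r jk ik ji wj wi).
have Est : mixT j (a * q') (a * r') (plane_vec i q r) = mixT i (a * q) (a * r) (plane_vec j q' r').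
  have sk : off_plane k.2 (plane_vec i q r) by apply: si.
  have sj : off_plane j.2 (plane_vec i q r) by apply: si.
  rewrite (mixT_sym (a * q) (a * r) q' r' ki kj ij) -(plane_vecZ i a q r).
  by rewrite (mixTZ q' r' a kj sk sj).
rewrite Est; set s := plane_vec i q r in si Est *; set t := plane_vec j q' r' in ti Est *.
have stX0 : sform s t = 0 by apply: form_plane_vec; apply: ti.
have ts0 : sform t s = 0 by apply: form_plane_vec; apply: si.
have sw0 : sform s w = 0 by apply: form_plane_vec.
have tw0 : sform t w = 0 by apply: form_plane_vec.
have ss0 : sform s s = 0 by apply: sformvv.
have tt0 : sform t t = 0 by apply: sformvv.
have -> : liftT i t a = liftT k t a by apply: liftT_plane_vec.
have -> : liftT j s a = liftT k s a by apply: liftT_plane_vec.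
have -> : liftT i w a = liftT j w a by apply: liftT_indep.
clearbody s t.
have sL p : i.2 != p -> levi p (liftT k s a).
  by move=> ip; apply: (levi_liftT _ (j := j)) => //; apply: si.
have tL p : j.2 != p -> levi p (liftT k t a).
  by move=> jp; apply: (levi_liftT _ (j := i)) => //; apply: ti.
have act_s v : sform s v = 0 -> act (liftT k s a) v = v.
  by move=> sv; apply: act_liftT_fix => //; apply: si.
have act_t v : sform t v = 0 -> act (liftT k t a) v = v.
  by move=> tv; apply: act_liftT_fix => //; apply: ti.
have ZsZt : commute (liftT k s a) (liftT k t a).
  apply: lconj_commute; rewrite lconj_liftT ?act_s //; last exact: ti.
  exact: sL.
have ZtYt : commute (liftT k t a) (mixT i (a * q) (a * r) t).
  apply: lconj_commute; rewrite lconj_mixT ?act_t //; last exact: ti.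
  exact: tL.
have ZtYw : commute (liftT k t a) (mixT i (a * q) (a * r) w).
  by apply: lconj_commute; rewrite lconj_mixT ?act_t //; apply: tL.
have ZsYw : commute (liftT k s a) (mixT j (a * q') (a * r') w).
  by apply: lconj_commute; rewrite lconj_mixT ?act_s //; apply: sL.
have ZsYt : commute (liftT k s a) (mixT i (a * q) (a * r) t).
  have -> : mixT i (a * q) (a * r) t = mixT j (a * q') (a * r') s by rewrite Est.
  apply: lconj_commute; rewrite lconj_mixT ?act_s //; last exact: si.
  exact: sL.
have YY : commute (mixT i (a * q) (a * r) w) (mixT j (a * q') (a * r') w).
  apply: lconj_commute; rewrite lconj_mixT ?mixT_fix //.
  exact: levi_mixT.
have mv (Zs Zt Yst Yi Yj Z : St) : commute Zs Zt -> commute Zt Yst ->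
    commute Zs Yst -> commute Zt Yi -> commute Zs Yj -> commute Yi Yj ->
    (Zs * (Yst * Yi) * (Zt * Yj * Z) = Zt * (Yst * Yj) * (Zs * Yi * Z))%g.
  move=> e1 e2 e3 e4 e5 e6.
  have -> : (Zs * (Yst * Yi) * (Zt * Yj * Z) = Zs * Yst * (Zt * Yi) * Yj * Z)%g.
    by rewrite e4 !mulgA.
  have -> : (Zt * (Yst * Yj) * (Zs * Yi * Z) = Zt * Yst * (Zs * Yj) * Yi * Z)%g.
    by rewrite e5 !mulgA.
  congr (_ * _)%g; rewrite -!mulgA [(Yst * (Zt * _))%g]mulgA -e2.
  rewrite [(Yst * (Zs * _))%g]mulgA -e3 e6 !mulgA.
  by rewrite e1.
exact: mv.
Qed.

Definition equivariant k i g := forall u a, lconj g (fullT k i u a) = fullT k i (act g u) a.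

Lemma equivariantM k i g g' : equivariant k i g -> equivariant k i g' -> equivariant k i (g * g')%g.
Proof. by move=> gE g'E u a; rewrite lconjMl g'E gE actM. Qed.

Lemma equivariantV k i g : equivariant k i g -> equivariant k i g^-1%g.
Proof.
move=> gE u a; apply: (can_inj (lconjK g)).
by rewrite gE -actM mulgV act1 -lconjMl mulgV /lconj mul1g invg1 mulg1.
Qed.

Lemma equivariant_levi k i g : k.2 != i.2 -> levi i.2 g ->
  (forall q r a, commute g (liftT k (plane_vec i q r) a)) -> equivariant k i g.
Proof.
move=> ki gi gZ u a; have vi := off_plane_off_part i u.
have gvi : off_plane i.2 (act g (off_part i u)) by apply: levi_off_plane.
have E : act g u = @plane_vec R l i (u i) (u (iopp i)) + act g (off_part i u).
  rewrite [in LHS](vec_split i u) actD; congr (_ + _).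
  by rewrite plane_vecE actD !actZ; case: (gi i) => // -> _; case: (gi (iopp i)) => // -> _.
rewrite E {1}(vec_split i u) !fullTE // lconjM (lconjM g (liftT _ _ _) (mixT _ _ _ _)) lconj_mixT // (lconj_liftT _ gi) //.
by congr (_ * _ * _)%g; apply/lconj_fix/gZ.
Qed.

(** The factor lifting T(s, 0, a) does not depend on k, and a third plane can be
    chosen on which the long root element acts. *)
Lemma equivariant_longX k i h c : k.2 != i.2 -> h.2 != i.2 -> equivariant k i (longX h c).
Proof.
move=> ki hi; apply: equivariant_levi => // [|q r a]; first exact: levi_longX.
have [n [ni nh _]] := plane3 i.2 h.2 h.2 hl.
have ih : off_plane h.2 (plane_vec i q r) by apply: off_plane_vec; rewrite eq_sym.
have iN : off_plane n.2 (plane_vec i q r) by apply: off_plane_vec; rewrite eq_sym.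
have L : levi n.2 (longX h c) by apply: levi_longX; rewrite eq_sym.
rewrite (liftT_plane_vec q r a ki ni); apply: lconj_commute.
rewrite lconj_liftT // act_longX transv_fix ?form0l // sformC form_plane_vec ?oppr0 //.
by apply: off_plane_bvec.
Qed.

(** As for long root elements, except that k has to avoid three planes, which is
    where centrality uses l >= 4. *)
Lemma equivariant_shortX k i h m c : k.2 != i.2 -> h.2 != m.2 -> h.2 != i.2 -> m.2 != i.2 ->
  equivariant k i (shortX h m c).
Proof.
move=> ki hm hi mi; apply: equivariant_levi => // [|q r a]; first exact: levi_shortX.
have [n [ni nh nm]] := plane3 i.2 h.2 m.2 hl.
have iN : off_plane n.2 (plane_vec i q r) by apply: off_plane_vec; rewrite eq_sym.
have L : levi n.2 (shortX h m c) by apply: levi_shortX; rewrite // eq_sym.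
have he : sform (e h) (plane_vec i q r) = 0 by apply: form_plane_vecr; apply: off_plane_bvec.
have me : sform (e m) (plane_vec i q r) = 0 by apply: form_plane_vecr; apply: off_plane_bvec.
rewrite (liftT_plane_vec q r a ki ni); apply: lconj_commute.
by rewrite lconj_liftT // act_shortX // transv_fix // sformZl me mulr0.
Qed.

Lemma stX_shortX h m a : stX h m a = shortX h (iopp m) (a * sg (iopp m)) :> St.
Proof. by rewrite /shortX ioppK -mulrA sgn_sqr mulr1. Qed.

(** A generator whose indices avoid the plane of i or that of j is covered by the
    previous lemmas and [fullT_indep]; the others are commutators of such. *)
Lemma equivariant_all k i j : k.2 != i.2 -> k.2 != j.2 -> i.2 != j.2 ->
  forall g, equivariant k i g.
Proof.
move=> ki kj ij; have swap g : equivariant k j g -> equivariant k i g.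
  by move=> gE u a; rewrite !(fullT_indep _ _ ki kj ij).
have Hst h m a : h.2 != m.2 -> ((h.2 != i.2) && (m.2 != i.2)) || ((h.2 != j.2) && (m.2 != j.2)) ->
    equivariant k i (stX h m a).
  rewrite stX_shortX => hm /orP[/andP[hi mi]|/andP[hj mj]]; first exact: equivariant_shortX.
  by apply/swap/equivariant_shortX.
apply: St_ind => [x y|x|h m a hm|]; [exact: equivariantM | exact: equivariantV | | ]; last first.
  by rewrite -(stX0 R i i); rewrite stX_diag => u a; rewrite /lconj act1 mul1g invg1 mulg1.
have [->|mh] := eqVneq m (iopp h).
  have [hi|hi] := eqVneq h.2 i.2; last exact: equivariant_longX.
  by apply/swap/equivariant_longX; rewrite ?hi.
have hm2 : h.2 != m.2.
  apply: contraNneq hm => hm2; apply: contraNeq mh => hm.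
  case: h m hm2 hm => [s p] [s' p'] /= <-; rewrite !xpair_eqE /= eqxx !andbT.
  by case: s s' => [] [].
have [ok|nok] := boolP (((h.2 != i.2) && (m.2 != i.2)) || ((h.2 != j.2) && (m.2 != j.2))).
  exact: Hst.
have [n [ni nj nh]] := plane3 i.2 j.2 h.2 hl.
have avoid (x : idx) : (x.2 != i.2) || (x.2 != j.2).
  by have [->|//] := eqVneq x.2 i.2; rewrite ij.
have nm : n.2 != m.2.
  by apply: contraNneq nok => nm; rewrite -nm ni nj !andbT avoid.
have -> : stX h m a = lcomm (stX h n a) (stX n m 1) :> St.
  by rewrite stX_R3 ?mulr1 // eq_sym.
have E1 : equivariant k i (stX h n a).
  apply: Hst; first by rewrite eq_sym.
  by rewrite ni nj !andbT avoid.
have E2 : equivariant k i (stX n m 1).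
  apply: Hst => //.
  by rewrite ni nj avoid.
rewrite lcommE; exact: (equivariantM (equivariantM (equivariantM E1 E2) (equivariantV E1)) (equivariantV E2)).
Qed.

Lemma fullT_bvec k i a : k.2 != i.2 -> fullT k i (e i) a = longX i a.
Proof.
move=> ki; have ik : i.2 != k.2 by rewrite eq_sym.
have E : e i = plane_vec i 1 0 + 0 :> vec by rewrite plane_vecE scale1r scale0r !addr0.
have i0 := @off_plane0 R l i.2; have k0 := @off_plane0 R l k.2.
rewrite {1}E fullTE //.
have Y1 : mixT i (a * 1) (a * 0) (0 : vec) = mixT i (0 * (a * 1)) (0 * (a * 0)) 0.
  by rewrite -(mixTZ _ _ 0 ki k0 i0) scaler0.
have Z1 (b : R) : liftT i (0 : vec) b = 1%g.
  rewrite /liftT /longC radX0 longX0 scaler0 radX0 /lconj mul1g invg1 mulg1 longXD subrr longX0 //.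
rewrite Z1 mulg1 mixTE !scaler0 !radX0 !longX0 Z1 !mulg1.
have -> : plane_vec i 1 0 = e i :> vec by rewrite plane_vecE scale1r scale0r addr0.
have eE : e i = (1 : R) *: e i :> vec by rewrite scale1r.
have kV c : off_plane i.2 (c *: e k) by apply: off_planeZ_bvec.
rewrite /liftT /longC [in radX (iopp k) _ _]eE (radX_sym (i := iopp k) _ ki) lconj_radX_longX //.
rewrite -mulgA longX_radX subrr (radX_sym _ ki) radXM // sformZl sformZr sformvv.
rewrite -scalerDl mulr1 [sg k * a]mulrC addNr scale0r !mulr0 !addr0 expr1n mulr1.
exact: radX0.
Qed.

Lemma ker_longX g i a : phi g = 1%g -> commute g (longX i a).
Proof.
move=> g1; have [k [ki _ _]] := plane3 i.2 i.2 i.2 hl.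
have [j [ji jk _]] := plane3 i.2 k.2 k.2 hl.
have gE : equivariant k i g by apply: (@equivariant_all k i j) => //; rewrite eq_sym.
have actg u : act g u = u by rewrite /act g1.
by apply: lconj_commute; rewrite -(fullT_bvec a ki) gE actg.
Qed.

(** The commutator of X_{i,-i}(a) with X_{-i,j}(eps_i) does not change when its
    second entry is multiplied by an element of the kernel, since the latter
    commutes with X_{i,-i}(a).  So g centralises it, and by R4 it centralises
    X_ij(a). *)
Lemma ker_stX g i j a : phi g = 1%g -> commute g (stX i j a).
Proof.
move=> g1; have [->|ij] := eqVneq j (iopp i); first exact: ker_longX.
have [e2|ij2] := eqVneq i.2 j.2.
  have -> : i = j.
    case: i j e2 ij => [s p] [s' p'] /= <-; rewrite /iopp xpair_eqE /= eqxx andbT.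
    by case: s s' => [] [].
  by rewrite stX_diag; apply: commute1.
pose x := stX (iopp i) j (sg i) : St; pose c := lcomm x^-1%g g.
have phic : phi c = 1%g.
  by rewrite /c lcommE !phiM !phiV g1 mulg1 invg1 mulg1 mulgV.
have gx : lconj g x = (x * c)%g by rewrite /c lcommE /lconj invgK !mulgA mulgV mul1g.
have gl : lconj g (longX i a) = longX i a by apply/lconj_fix/ker_longX.
have cl : lcomm (longX i a) c = 1%g by apply/lcomm1P/commute_sym/ker_longX.
have : commute g (lcomm (longX i a) x).
  by apply: lconj_commute; rewrite lconjR gl gx lcommMr cl lconj1 mulg1.
rewrite /x /longX stX_R4 // -mulrA sgn_sqr mulr1 => H.
have -> : stX i j a = (stX i j a * stX (iopp j) j (- (a * sg i ^+ 2)) *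
    (stX (iopp j) j (- (a * sg i ^+ 2)))^-1)%g by rewrite mulgK.
apply: commuteM => //; apply: commuteV.
by rewrite -{2}[j]ioppK; apply: ker_longX.
Qed.

Theorem ker_central g x : phi g = 1%g -> commute g x.
Proof.
move=> g1; elim/St_ind: x => [x y|x|i j a ij|].
- exact: commuteM.
- exact: commuteV.
- exact: ker_stX.
- exact: commute1.
Qed.

End Central.

(** * The Schur multiplier of the elementary symplectic group *)

Unset Implicit Arguments.

Theorem corollary1 (R : comPzRingType) (l : nat) (hl : (4 <= l)%N) :
  exists f : {multiplicative K2Sp R l -> Algebra.to_multiplicative (H2 (Ep R l))},
    bijective f.
Proof.
have [psi psiM psi_phi] := St_lift hl (@taut_projM (Ep R l)) (@taut_proj_surj _) (@taut_proj_central _).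
pose kv (k : K2Sp R l) : StSp R l := k2_val k.
have kvM : {morph kv : x y / (x * y)%g} by move=> x y; exact: valM.
have kv_inj : injective kv by exact: val_inj.
have kvP x : phi x = 1%g <-> exists k, kv k = x.
  split=> [x1|[[y /eqP y1] <-//]].
  have x1' : in_K2Sp x by apply/eqP.
  by exists (MkK2Sp x1').
have kerC x y : phi x = 1%g -> commute x y := @ker_central R l hl x y.
have perf := @St_perfect R l hl.
have phiM : {morph @phi R l : x y / (x * y)%g} by exact: gmulfM.
have sM := schurM kvM kvP perf psiM psi_phi.
have sB := schur_bij phiM (@phi_surj R l) kvM kv_inj kvP kerC perf psiM psi_phi.
pose f : K2Sp R l -> Algebra.to_multiplicative (H2 (Ep R l)) := schur kv psi.
have fM : {morph f : x y / (x * y)%g} := sM.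
pose F := isMultiplicative.Build _ _ f fM.
by exists (HB.pack_for {multiplicative K2Sp R l -> Algebra.to_multiplicative (H2 (Ep R l))} f F).
Qed.
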